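(* Let $X$ be a complex Banach space and let $T$ be a closed linear relation in $X$. Suppose $S$ is a linear relation in $X$ which is $T$-compact with $T$-bound $b<1$, and such that $D(S)\supset\overline{D(T)}$ and $S(0)\subset T(0)$. Then for $i=1,2,3,4$, $$\sigma_{ei}(T+S)=\sigma_{ei}(T).$$ If additionally $\rho_{e4}(T)$ is connected and neither $\rho(T)$ nor $\rho(T+S)$ is empty, then $$\sigma_{e5}(T+S)=\sigma_{e5}(T).$$
   Context: A linear relation $T$ in $X$ (written $T\in LR(X)$) is a set-valued map whose graph $G(T)=\{(x,y): y\in Tx\}$ is a linear subspace of $X\times X$. Its domain is $D(T)=\{x: Tx\neq\emptyset\}$, its range is $R(T)=\bigcup_{x\in D(T)}Tx$, its null space is $N(T)=\{x\in D(T): 0\in Tx\}$, and $T(0)=\{y:(0,y)\in G(T)\}$. $T$ is closed if $G(T)$ is closed. Sums: $D(T+S)=D(T)\cap D(S)$ and $(T+S)x=Tx+Sx$; $\lambda-T$ means $\lambda I-T$. Let $Q_T: X\to X/\overline{T(0)}$ be the quotient map; $Q_TT$ is a single-valued operator. For $x\in D(T)$, $\|Tx\|:=\|Q_TTx\|$ (the distance from $y$ to $T(0)$, for any $y\in Tx$). A linear relation $K$ from a normed space $Z$ to $X$ is compact if the image under the single-valued operator $Q_KK$ of the unit ball of $D(K)$ is relatively compact in $X/\overline{K(0)}$. Let $X_T$ be the vector space $D(T)$ with norm $\|x\|_T=\|x\|+\|Tx\|$ and let $G_T:X_T\to X$ be the identity injection. $S$ is $T$-compact if $SG_T$ is compact.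 $S$ has $T$-bound $b<1$ means there are constants $a,b>0$ with $b<1$ such that $\|Sx\|\le a\|x\|+b\|Tx\|$ for all $x\in D(T)$. Let $\alpha(T)=\dim N(T)$, $\beta(T)=\dim X/R(T)$, and $\kappa(T)=\alpha(T)-\beta(T)$ when at least one of these is finite (with value $\infty$ if only $\alpha(T)=\infty$, and $-\infty$ if only $\beta(T)=\infty$). A closed linear relation $T$ belongs to $\Phi_+$ if $R(T)$ is closed and $\alpha(T)<\infty$; to $\Phi_-$ if $R(T)$ is closed and $\beta(T)<\infty$; and $\Phi=\Phi_+\cap\Phi_-$. The resolvent set $\rho(T)$ of a closed relation in $X$ is the set of $\lambda\in\mathbb{C}$ such that $N(\lambda-T)=\{0\}$ and $R(\lambda-T)=X$; $\sigma(T)=\mathbb{C}\setminus\rho(T)$. Essential resolvent sets: $\rho_{e1}(T)=\{\lambda\in\mathbb{C}:\lambda-T\in\Phi_+\cup\Phi_-\}$; $\rho_{e2}(T)=\{\lambda:\lambda-T\in\Phi_+\}$; $\rho_{e3}(T)=\{\lambda:\lambda-T\in\Phi\}$; $\rho_{e4}(T)=\{\lambda:\lambda-T\in\Phi,\ \kappa(\lambda-T)=0\}$; $\rho_{e5}(T)$ is the union of those connected components of $\rho_{e1}(T)$ that intersect $\rho(T)$. The essential spectra are $\sigma_{ei}(T)=\mathbb{C}\setminus\rho_{ei}(T)$, $i=1,\dots,5$. *)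

(* Defs.v *)
From HB Require Import structures.
From mathcomp Require Import all_boot all_order all_algebra.
From mathcomp Require Import complex generic_quotient ring_quotient.
From mathcomp Require Import all_classical all_reals all_analysis.
Import Order.TTheory GRing.Theory Num.Theory numFieldNormedType.Exports.

Set Implicit Arguments.
Unset Strict Implicit.
Unset Printing Implicit Defensive.

Local Open Scope classical_set_scope.
Local Open Scope ring_scope.
Local Open Scope complex_scope.

Definition is_subspace (K : fieldType) (V : lmodType K) (A : set V) :=
  A 0 /\ forall (a : K) (u v : V), A u -> A v -> A (a *: u + v).

(* A subspace of V, not necessarily closed or finite-dimensional. *)
Record vsubspace (K : fieldType) (V : lmodType K) := VSubspace {
  vs_set : set V;
  vs_setP : is_subspace vs_set
}.

Section Subspaces.
Context {K : fieldType} {V : lmodType K}.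
Implicit Type M : vsubspace V.

Lemma vs_set0 M : vs_set M 0. Proof. by case: (vs_setP M). Qed.

Lemma vs_lin M a x y : vs_set M x -> vs_set M y -> vs_set M (a *: x + y).
Proof. by case: (vs_setP M) => _; exact. Qed.

Lemma vs_setZ M a x : vs_set M x -> vs_set M (a *: x).
Proof. by move=> Mx; rewrite -[_ *: _]addr0; apply: vs_lin => //; exact: vs_set0. Qed.

Definition vs_pred M : {pred V} := fun x => `[< vs_set M x >].

Lemma vs_submod_closed M : GRing.submod_closed (vs_pred M).
Proof.
case: (vs_setP M) => M0 Ml; split; first exact/asboolP.
by move=> a u v /asboolP Mu /asboolP Mv; apply/asboolP; exact: Ml.
Qed.

HB.instance Definition _ M :=
  GRing.isSubmodClosed.Build K V (vs_pred M) (vs_submod_closed M).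

Definition subsp M := {x : V | vs_pred M x}.
HB.instance Definition _ M := [isSub of subsp M for sval].
HB.instance Definition _ M := [Choice of subsp M by <:].
HB.instance Definition _ M := [SubChoice_isSubLmodule of subsp M by <:].

(* The vector space V / M. *)
Definition quotsp M := Quotient.quot (vs_pred M).
HB.instance Definition _ M := GRing.Zmodule.on (quotsp M).

Definition toquot M (x : V) : quotsp M := \pi_(Quotient.quot (vs_pred M))%qT x.

Lemma toquotP M x y : toquot M x = toquot M y <-> vs_set M (x - y).
Proof.
have := Quotient.idealrBE (vs_pred M) x y; rewrite /toquot => E; split.
- by move/eqP; rewrite -E => /asboolP.
- by move=> Mxy; apply/eqP; rewrite -E; apply/asboolP.
Qed.

Definition quotsp_repr M (q : quotsp M) : V :=
  repr (q : Quotient.quot (vs_pred M)).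

Lemma quotsp_reprK M : cancel (@quotsp_repr M) (toquot M).
Proof. by move=> q; rewrite /toquot /quotsp_repr reprK. Qed.

Lemma toquotD M x y : toquot M (x + y) = toquot M x + toquot M y.
Proof. exact: (raddfD (\pi_(Quotient.quot (vs_pred M))%qT)). Qed.

Lemma toquot0 M : toquot M 0 = 0.
Proof. exact: (raddf0 (\pi_(Quotient.quot (vs_pred M))%qT)). Qed.

Definition quotsp_scale M (a : K) (q : quotsp M) : quotsp M :=
  toquot M (a *: quotsp_repr q).

Lemma toquotZ M a x : toquot M (a *: x) = quotsp_scale a (toquot M x).
Proof.
apply/toquotP; rewrite -scalerBr; apply: vs_setZ; apply/toquotP.
by rewrite quotsp_reprK.
Qed.

Fact quotsp_scaleA M a b (q : quotsp M) :
  quotsp_scale a (quotsp_scale b q) = quotsp_scale (a * b) q.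
Proof. by rewrite -(quotsp_reprK q) -!toquotZ scalerA. Qed.

Fact quotsp_scale1 M : left_id 1 (@quotsp_scale M).
Proof. by move=> q; rewrite -(quotsp_reprK q) -toquotZ scale1r. Qed.

Fact quotsp_scaleDr M : right_distributive (@quotsp_scale M) +%R.
Proof.
move=> a p q; rewrite -(quotsp_reprK q) -(quotsp_reprK p) -toquotD -!toquotZ.
by rewrite -toquotD scalerDr.
Qed.

Fact quotsp_scaleDl M (q : quotsp M) :
  {morph (@quotsp_scale M)^~ q : a b / a + b}.
Proof. by move=> a b; rewrite -(quotsp_reprK q) -!toquotZ -toquotD scalerDl. Qed.

HB.instance Definition _ M := GRing.Zmodule_isLmodule.Build K (quotsp M)
  (@quotsp_scaleA M) (@quotsp_scale1 M) (@quotsp_scaleDr M) (@quotsp_scaleDl M).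

End Subspaces.

Section Dimension.
Context {K : fieldType}.

Definition has_basis_of_size (V : lmodType K) (n : nat) :=
  exists e : 'I_n -> V,
    forall v, exists! c : {ffun 'I_n -> K}, v = \sum_i c i *: e i.

(* +oo when there is no finite basis. *)
Definition vdim (V : lmodType K) : \bar int :=
  xget +oo%E [set d | exists2 n : nat, has_basis_of_size V n & d = n%:Z%:E].
End Dimension.

(* A linear relation from Z to X is given by its graph. *)
Notation linrel Z X := (vsubspace (Z * X)%type).

Section LinearRelations.
Context {K : fieldType} {Z X : lmodType K}.
Implicit Types T S : linrel Z X.

(* T x, as a subset of X. *)
Definition lr_val T (x : Z) : set X := [set y | vs_set T (x, y)].

Lemma lr_val0 T : lr_val T 0 0. Proof. exact: (vs_set0 T). Qed.

Lemma lr_val_lin T a x x' y y' :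
  lr_val T x y -> lr_val T x' y' -> lr_val T (a *: x + x') (a *: y + y').
Proof. exact: (@vs_lin _ _ T a (x, y) (x', y')). Qed.

Fact lr_dom_subspace T : is_subspace [set x | lr_val T x !=set0].
Proof.
split; first by exists 0; exact: lr_val0.
by move=> a u v [y Ty] [y' Ty']; exists (a *: y + y'); exact: lr_val_lin.
Qed.
Definition lr_dom T := VSubspace (lr_dom_subspace T).

Fact lr_ran_subspace T :
  is_subspace (\bigcup_(x in [set x | lr_val T x !=set0]) lr_val T x).
Proof.
split; first by exists 0; [exists 0|]; exact: lr_val0.
move=> a u v [x Dx Tx] [x' Dx' Tx']; exists (a *: x + x').
  exact: (lr_dom_subspace T).2.
exact: lr_val_lin.
Qed.
Definition lr_ran T := VSubspace (lr_ran_subspace T).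

Fact lr_ker_subspace T : is_subspace [set x | lr_val T x 0].
Proof.
split; first exact: lr_val0.
move=> a u v Tu Tv /=.
by have := lr_val_lin a Tu Tv; rewrite scaler0 addr0.
Qed.
Definition lr_ker T := VSubspace (lr_ker_subspace T).

Fact lr_mul_subspace T : is_subspace (lr_val T 0).
Proof.
split; first exact: lr_val0.
move=> a u v Tu Tv.
by have := lr_val_lin a Tu Tv; rewrite scaler0 addr0.
Qed.
(* The multivalued part T(0). *)
Definition lr_mul T := VSubspace (lr_mul_subspace T).

Fact lr_add_subspace T S : is_subspace [set p : Z * X |
  exists y z, [/\ lr_val T p.1 y, lr_val S p.1 z & p.2 = y + z]].
Proof.
split; first by exists 0, 0; split; [exact: lr_val0|exact: lr_val0|rewrite addr0].
move=> a [x t] [x' t'] [y [z [Ty Sz /= ->]]] [y' [z' [Ty' Sz' /= ->]]].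
exists (a *: y + y'), (a *: z + z').
split; [exact: lr_val_lin | exact: lr_val_lin |].
by rewrite /= scalerDr addrACA.
Qed.
Definition lr_add T S : linrel Z X := VSubspace (lr_add_subspace T S).

Fact lr_opp_subspace T :
  is_subspace [set p : Z * X | exists2 y, lr_val T p.1 y & p.2 = - y].
Proof.
split; first by exists 0; [exact: lr_val0 | rewrite oppr0].
move=> a [x t] [x' t'] [y Ty /= ->] [y' Ty' /= ->].
exists (a *: y + y'); first exact: lr_val_lin.
by rewrite /= opprD scalerN.
Qed.
Definition lr_opp T : linrel Z X := VSubspace (lr_opp_subspace T).

Fact lr_fun_subspace (f : {linear Z -> X}) :
  is_subspace [set p : Z * X | p.2 = f p.1].
Proof.
split; first by rewrite /= raddf0.
by move=> a [x t] [x' t'] /= -> ->; rewrite linearP.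
Qed.
Definition lr_fun (f : {linear Z -> X}) : linrel Z X :=
  VSubspace (lr_fun_subspace f).
End LinearRelations.

Fact lr_comp_subspace (K : fieldType) (W Z X : lmodType K)
    (S : linrel Z X) (T : linrel W Z) :
  is_subspace [set p : W * X | exists2 z, lr_val T p.1 z & lr_val S z p.2].
Proof.
split; first by exists 0; exact: lr_val0.
move=> a [w x] [w' x'] [z Tz Sz] [z' Tz' Sz'].
by exists (a *: z + z'); exact: lr_val_lin.
Qed.
Definition lr_comp (K : fieldType) (W Z X : lmodType K)
    (S : linrel Z X) (T : linrel W Z) : linrel W X :=
  VSubspace (lr_comp_subspace S T).

(* The relation lambda I - T. *)
Definition lr_shift (K : fieldType) (X : lmodType K) (lambda : K)
    (T : linrel X X) : linrel X X :=
  lr_add (lr_fun (lambda \*: idfun)) (lr_opp T).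

Section NormedQuotient.
Context {R : realType} {X : normedModType R[i]}.
Implicit Type M : vsubspace X.

(* The library norm of a complex normed module takes its (real, nonnegative)
   values in R[i]; rnorm is the same norm with values in R. *)
Definition rnorm (x : X) : R := complex.Re `|x|.

Lemma rnormE x : (rnorm x)%:C = `|x|.
Proof. by rewrite /rnorm RRe_real// ger0_real. Qed.

Lemma rnorm_ge0 x : 0 <= rnorm x.
Proof. by rewrite -ler0c rnormE. Qed.

Lemma rnormD x y : rnorm (x + y) <= rnorm x + rnorm y.
Proof. by rewrite -lecR rmorphD /= !rnormE ler_normD. Qed.

Lemma rnormZ a x : rnorm (a *: x) = complex.Re `|a| * rnorm x.
Proof.
have aE : (complex.Re `|a|)%:C = `|a| by rewrite RRe_real// ger0_real.
by apply: complexI; rewrite [RHS](rmorphM (real_complex R)) /= !rnormE normrZ aE.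
Qed.

Lemma rnorm_closureP (A : set X) x :
  closure A x <-> forall e : R, 0 < e -> exists2 y, A y & rnorm (x - y) < e.
Proof.
split=> [clA e e0|H B /nbhs_ballP[e /= e0 eB]].
  have eC : 0 < e%:C :> R[i] by rewrite ltcR.
  have [y [Ay]] := clA _ (nbhsx_ballx x _ eC).
  by rewrite -ball_normE /= -rnormE ltcR => ?; exists y.
have er : e = (complex.Re e)%:C by rewrite RRe_real// gtr0_real.
have [|y Ay xy] := H (complex.Re e); first by rewrite -ltcR -er.
exists y; split=> //; apply: eB; rewrite -ball_normE /= er -rnormE.
by rewrite ltcR.
Qed.

Fact vs_closure_subspace M : is_subspace (closure (vs_set M)).
Proof.
split; first by apply: subset_closure; exact: vs_set0.
move=> a u v /rnorm_closureP Mu /rnorm_closureP Mv; apply/rnorm_closureP => e e0.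
have n0 : 0 < complex.Re `|a| + 1.
  by rewrite ltr_wpDl// -ler0c RRe_real// ger0_real.
have [|u' Mu' uu'] := Mu (e / 2 / (complex.Re `|a| + 1)).
  by rewrite !divr_gt0.
have [|v' Mv' vv'] := Mv (e / 2); first by rewrite divr_gt0.
exists (a *: u' + v'); first exact: vs_lin.
rewrite opprD addrACA -scalerBr; apply: (le_lt_trans (rnormD _ _)).
rewrite [ltRHS]splitr; apply: ler_ltD => //; rewrite rnormZ.
apply: (@le_trans _ _ ((complex.Re `|a| + 1) * rnorm (u - u'))).
  by rewrite ler_wpM2r ?rnorm_ge0// lerDl.
by rewrite mulrC -ler_pdivlMr// ltW.
Qed.
Definition vs_closure M := VSubspace (vs_closure_subspace M).

(* X / closure M with the quotient norm. *)
Definition nquot M : Type := quotsp (vs_closure M).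
HB.instance Definition _ M := GRing.Lmodule.on (nquot M).

Definition to_nquot M (x : X) : nquot M := toquot (vs_closure M) x.

Definition nquot_rnorm M (q : nquot M) : R :=
  inf [set rnorm x | x in [set x | to_nquot M x = q]].

Let nquot_has_inf M (q : nquot M) :
  has_inf [set rnorm x | x in [set x | to_nquot M x = q]].
Proof.
split; first by exists (rnorm (quotsp_repr q)), (quotsp_repr q) => //=;
  exact: quotsp_reprK.
by exists 0 => _ [x _ <-]; exact: rnorm_ge0.
Qed.

Let nquot_rnorm_le M (x : X) : nquot_rnorm (to_nquot M x) <= rnorm x.
Proof. by apply: ge_inf; [case: (nquot_has_inf (to_nquot M x)) | exists x]. Qed.

Let nquot_rnorm_adh M (q : nquot M) (e : R) : 0 < e ->
  exists2 x, to_nquot M x = q & rnorm x < nquot_rnorm q + e.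
Proof.
by move=> e0; have [_ [x xq <-] ?] := inf_adherent e0 (nquot_has_inf q); exists x.
Qed.

Let nquot_rnorm_ge0 M (q : nquot M) : 0 <= nquot_rnorm q.
Proof.
apply: lb_le_inf; first by case: (nquot_has_inf q).
by move=> _ [x _ <-]; exact: rnorm_ge0.
Qed.

Fact nquot_normD M (p q : nquot M) :
  (nquot_rnorm (p + q))%:C <= (nquot_rnorm p)%:C + (nquot_rnorm q)%:C.
Proof.
rewrite -rmorphD lecR; apply/ler_addgt0Pr => e e0.
have e20 : 0 < e / 2 by rewrite divr_gt0.
have [x xp lx] := nquot_rnorm_adh p e20; have [y yq ly] := nquot_rnorm_adh q e20.
have -> : p + q = to_nquot M (x + y) by rewrite -xp -yq /to_nquot toquotD.
apply: (le_trans (nquot_rnorm_le _ _)); apply: (le_trans (rnormD _ _)).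
by rewrite (splitr e) addrACA; apply: lerD; apply: ltW.
Qed.

Let nquot_rnormZ_le M (a : R[i]) (q : nquot M) :
  nquot_rnorm (a *: q) <= complex.Re `|a| * nquot_rnorm q.
Proof.
have a0 : 0 <= complex.Re `|a| by rewrite -ler0c RRe_real// ger0_real.
apply/ler_addgt0Pr => e e0.
have n0 : 0 < complex.Re `|a| + 1 by rewrite ltr_wpDl.
have [|x xq lx] := @nquot_rnorm_adh M q (e / (complex.Re `|a| + 1)).
  by rewrite divr_gt0.
have -> : a *: q = to_nquot M (a *: x) by rewrite /to_nquot toquotZ -xq.
apply: (le_trans (nquot_rnorm_le _ _)); rewrite rnormZ.
apply: (@le_trans _ _ (complex.Re `|a| *
    (nquot_rnorm q + e / (complex.Re `|a| + 1)))).
  by rewrite ler_wpM2l// ltW.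
by rewrite mulrDr lerD2l mulrCA ger_pMr// ler_pdivrMr// mul1r lerDl.
Qed.

Fact nquot_normZ M (a : R[i]) (q : nquot M) :
  (nquot_rnorm (a *: q))%:C = `|a| * (nquot_rnorm q)%:C.
Proof.
have aE : (complex.Re `|a|)%:C = `|a| by rewrite RRe_real// ger0_real.
suff -> : nquot_rnorm (a *: q) = complex.Re `|a| * nquot_rnorm q.
  by rewrite [LHS](rmorphM (real_complex R)) /= aE.
apply: le_anti; rewrite nquot_rnormZ_le andTb.
have [a0|a0] := eqVneq a 0.
  have -> : complex.Re `|a| = 0 by apply: complexI; rewrite aE a0 normr0.
  by rewrite mul0r.
have a1 : 0 < complex.Re `|a| by rewrite -ltcR aE normr_gt0.
rewrite mulrC -ler_pdivlMr//.
have := nquot_rnormZ_le a^-1 (a *: q).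
rewrite scalerA mulVf// scale1r => /le_trans; apply.
suff -> : complex.Re `|a^-1| = (complex.Re `|a|)^-1 by rewrite mulrC.
have bE : (complex.Re `|a^-1|)%:C = `|a^-1| by rewrite RRe_real// ger0_real.
apply: complexI; rewrite bE normfV -aE.
by rewrite (fmorphV (real_complex R)).
Qed.

Fact nquot_norm0_eq0 M (q : nquot M) : (nquot_rnorm q)%:C = 0 -> q = 0.
Proof.
move=> /complexI q0; rewrite -(quotsp_reprK q) -[RHS]toquot0.
apply/toquotP; rewrite subr0.
apply: (@closed_closure _ (vs_set M)); apply/rnorm_closureP => e e0.
have [x xq] := nquot_rnorm_adh q e0; rewrite q0 add0r => xe.
exists (quotsp_repr q - x); last by rewrite opprB addrC subrK.
by apply: (toquotP (vs_closure M) _ _).1; rewrite quotsp_reprK -xq.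
Qed.

HB.instance Definition _ M := Lmodule_isNormed.Build R[i] (nquot M)
  (@nquot_normD M) (@nquot_normZ M) (@nquot_norm0_eq0 M).

End NormedQuotient.

Section QuotientOperator.
Context {R : realType} {Z X : normedModType R[i]}.
Implicit Types T : linrel Z X.

(* The single-valued operator Q_T T : D(T) -> X / closure T(0); the choice of
   the element of T x is immaterial by qopE. *)
Definition qop T (x : Z) : nquot (lr_mul T) :=
  to_nquot (lr_mul T) (xget 0 (lr_val T x)).

Lemma qopE T x y : lr_val T x y -> qop T x = to_nquot (lr_mul T) y.
Proof.
move=> Txy; apply/toquotP; apply: subset_closure.
have Tx : lr_val T x (xget 0 (lr_val T x)) by apply: (xgetI 0 Txy).
have := lr_val_lin (-1) Txy Tx.
by rewrite !scaleN1r addNr addrC.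
Qed.

Lemma qop_linear T a x y : vs_set (lr_dom T) x -> vs_set (lr_dom T) y ->
  qop T (a *: x + y) = a *: qop T x + qop T y.
Proof.
move=> [x' Tx] [y' Ty]; rewrite (qopE Tx) (qopE Ty) (qopE (lr_val_lin a Tx Ty)).
by rewrite /to_nquot toquotD toquotZ.
Qed.

(* The space X_T: the vector space D(T) with the graph norm. *)
Definition graphdom T : Type := subsp (lr_dom T).
HB.instance Definition _ T := GRing.SubLmodule.on (graphdom T).

Lemma graphdomP T (u : graphdom T) : vs_set (lr_dom T) (val u).
Proof. by apply/asboolP; exact: (valP u). Qed.

Definition graph_norm T (u : graphdom T) : R[i] := `|val u| + `|qop T (val u)|.

Fact graph_normD T (u v : graphdom T) :
  graph_norm (u + v) <= graph_norm u + graph_norm v.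
Proof.
rewrite /graph_norm raddfD /= addrACA lerD ?ler_normD//.
have := qop_linear 1 (graphdomP u) (graphdomP v); rewrite !scale1r => ->.
exact: ler_normD.
Qed.

Fact graph_normZ T a (u : graphdom T) :
  graph_norm (a *: u) = `|a| * graph_norm u.
Proof.
rewrite /graph_norm linearZ /= normrZ mulrDr; congr (_ + _).
have := qop_linear a (graphdomP u) (vs_set0 (lr_dom T)).
rewrite addr0 => ->; rewrite (qopE (lr_val0 T)).
by rewrite /to_nquot toquot0 addr0 normrZ.
Qed.

Fact graph_norm0_eq0 T (u : graphdom T) : graph_norm u = 0 -> u = 0.
Proof.
move=> u0; apply/val_inj/normr0_eq0/le_anti; rewrite normr_ge0 andbT -u0.
by rewrite lerDl.
Qed.

HB.instance Definition _ T := Lmodule_isNormed.Build R[i] (graphdom T)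
  (@graph_normD T) (@graph_normZ T) (@graph_norm0_eq0 T).

Definition graphdom_inj T : linrel (graphdom T) Z :=
  lr_fun (val : {linear graphdom T -> Z}).

Definition compact_linrel T :=
  precompact (qop T @` [set x | vs_set (lr_dom T) x /\ `|x| <= 1]).

End QuotientOperator.

Section EssentialSpectra.
Context {R : realType} {X : normedModType R[i]}.
Implicit Types T S : linrel X X.

Definition rel_compact S T := compact_linrel (lr_comp S (graphdom_inj T)).

Definition rel_bound_lt1 S T := exists a b : R, [/\ 0 < a, 0 < b, b < 1 &
  forall x, vs_set (lr_dom T) x ->
    `|qop S x| <= a%:C * `|x| + b%:C * `|qop T x|].

Definition closed_linrel T := closed (vs_set T).

Definition lr_alpha T : \bar int := vdim (subsp (lr_ker T)).
Definition lr_beta T : \bar int := vdim (quotsp (lr_ran T)).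

(* Only meaningful when lr_alpha T or lr_beta T is finite. *)
Definition lr_kappa T : \bar int := (lr_alpha T - lr_beta T)%E.

Definition PhiPlus T :=
  [/\ closed_linrel T, closed (vs_set (lr_ran T)) & (lr_alpha T < +oo)%E].
Definition PhiMinus T :=
  [/\ closed_linrel T, closed (vs_set (lr_ran T)) & (lr_beta T < +oo)%E].
Definition Phi T := PhiPlus T /\ PhiMinus T.

(* Sets of scalars live in R[i]^o, which carries the usual topology of the
   complex plane. *)
Definition resolvent_set T : set R[i]^o := [set lambda |
  vs_set (lr_ker (lr_shift lambda T)) = [set 0] /\
  vs_set (lr_ran (lr_shift lambda T)) = setT].

Definition rho_e1 T : set R[i]^o := [set lambda |
  PhiPlus (lr_shift lambda T) \/ PhiMinus (lr_shift lambda T)].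
Definition rho_e2 T : set R[i]^o := [set lambda | PhiPlus (lr_shift lambda T)].
Definition rho_e3 T : set R[i]^o := [set lambda | Phi (lr_shift lambda T)].
Definition rho_e4 T : set R[i]^o := [set lambda |
  Phi (lr_shift lambda T) /\ lr_kappa (lr_shift lambda T) = 0%E].
Definition rho_e5 T : set R[i]^o :=
  \bigcup_(C in [set connected_component (rho_e1 T) x | x in rho_e1 T] `&`
                [set C | C `&` resolvent_set T !=set0]) C.

Definition sigma_e1 T := ~` rho_e1 T.
Definition sigma_e2 T := ~` rho_e2 T.
Definition sigma_e3 T := ~` rho_e3 T.
Definition sigma_e4 T := ~` rho_e4 T.
Definition sigma_e5 T := ~` rho_e5 T.

End EssentialSpectra.

(* Main.v *)
Require Import Defs.
From mathcomp Require Import all_boot all_order all_algebra complex ring lra.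
From mathcomp Require Import all_classical all_reals all_analysis.
Import Order.TTheory GRing.Theory Num.Theory numFieldNormedType.Exports.
Local Open Scope classical_set_scope.
Local Open Scope ring_scope.

Set Implicit Arguments.
Unset Strict Implicit.
Unset Printing Implicit Defensive.

(* A relation [A] is handled through its graph; [A + dS] is [lr_pert A S d], and everything
   is proved along the segment [A_r = lambda - (T + rS)], [0 <= r <= 1].  Because of
   [S(0) <= T(0)] all the [A_r] have the same multivalued part and [A_r' = A_r - (r' - r) S],
   and because the [T]-bound is smaller than 1 all the [A_r] are closed and [S] is compact
   relative to each of them: modulo [S(0)], the values of [S] on the unit ball of the graph
   of [A_r] lie within any given distance of a finite set.

   [Phi_+]: a closed relation [A] is in [Phi_+] iff the sets [{|x| <= 1, |Ax| <= d}] have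
   finite [e]-nets for [d] small; this passes from [A_r] to [A_r'].

   [Phi_-]: if [R(A_r) + F = X] with [F] finite dimensional, the open mapping theorem and the
   finite nets show that every [y] in the unit ball is, up to an error of norm at most 1/2,
   in a bounded part of [R(A_r') + F'], with [F'] finite dimensional; iterating,
   [R(A_r') + F' = X].

   Index: if [A] is Fredholm, [F] is a complement of [R(A)] and [d] is small, then
   [R(A + dS) + F = X] and the preimage of [F] under [A + dS] has the dimension of [N(A)],
   so that the index of [A + dS] is [dim N(A) - dim F].  The index is thus locally constant
   in [r], hence the same at [r = 0] and [r = 1].

   The fifth spectrum: the connected set [rho_e4(T) = rho_e4(T + S)] contains both resolvent
   sets, so that a single component of [rho_e1] is involved. *)

(** * Norms with real values and geometric sequences *)

Section RealNorm.
Context {R : realType}.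
Local Open Scope complex_scope.

Section OneSpace.
Context {V : normedModType R[i]}.
Implicit Types x y : V.

Lemma rnorm0 : rnorm (0 : V) = 0.
Proof. by rewrite /rnorm normr0. Qed.

Lemma rnorm_eq0 x : rnorm x = 0 -> x = 0.
Proof. by move=> x0; apply: normr0_eq0; rewrite -rnormE x0. Qed.

Lemma rnorm_gt0 x : x != 0 -> 0 < rnorm x.
Proof.
move=> x0; rewrite lt_neqAle rnorm_ge0 andbT eq_sym.
by apply/eqP => /rnorm_eq0 /eqP; rewrite (negbTE x0).
Qed.

Lemma rnormN x : rnorm (- x) = rnorm x.
Proof. by rewrite /rnorm normrN. Qed.

Lemma rnormB x y : rnorm (x - y) <= rnorm x + rnorm y.
Proof. by rewrite -(rnormN y) rnormD. Qed.

Lemma rnorm_distC x y : rnorm (x - y) = rnorm (y - x).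
Proof. by rewrite -rnormN opprB. Qed.

Lemma rnorm_triangle y x z : rnorm (x - z) <= rnorm (x - y) + rnorm (y - z).
Proof. by rewrite (le_trans _ (rnormD _ _))// addrA subrK. Qed.

Lemma rnorm_scale (r : R) x : 0 <= r -> rnorm (r%:C *: x) = r * rnorm x.
Proof. by move=> r0; rewrite rnormZ normc_def /= expr0n addr0 sqrtr_sqr ger0_norm. Qed.

Lemma rnorm_sum n (F : 'I_n -> V) : rnorm (\sum_i F i) <= \sum_i rnorm (F i).
Proof.
elim/big_ind2 : _ => //; first by rewrite rnorm0.
by move=> x a y b xa yb; rewrite (le_trans (rnormD _ _))// lerD.
Qed.

Lemma rnorm_small_eq0 x : (forall e : R, 0 < e -> rnorm x < e) -> x = 0.
Proof.
move=> xe; apply: contrapT => /eqP x0.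
by have := xe _ (rnorm_gt0 x0); rewrite ltxx.
Qed.

Lemma rnorm_closed (A : set V) x : closed A ->
  (forall e : R, 0 < e -> exists2 y, A y & rnorm (x - y) < e) -> A x.
Proof. by move=> cA Ax; apply: cA; apply/rnorm_closureP. Qed.

Lemma closed_rnorm (A : set V) :
  (forall x, (forall e : R, 0 < e -> exists2 y, A y & rnorm (x - y) < e) -> A x) ->
  closed A.
Proof. by move=> H x /rnorm_closureP; exact: H. Qed.

Lemma rnorm_normalize x : x != 0 -> rnorm ((rnorm x)^-1%:C *: x) = 1.
Proof.
move=> x0; have p := rnorm_gt0 x0.
by rewrite rnorm_scale ?invr_ge0 ?rnorm_ge0// mulVf// gt_eqF.
Qed.

End OneSpace.

Section Pairs.
Context {V W : normedModType R[i]}.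

Lemma rnorm_pair (x : V) (y : W) : rnorm (x, y) = Num.max (rnorm x) (rnorm y).
Proof.
apply: complexI; rewrite rnormE prod_normE /= -!rnormE.
by rewrite /Order.max ltcR; case: (_ < _).
Qed.

Lemma rnorm_pairB (p q : V * W) :
  rnorm (p - q) = Num.max (rnorm (p.1 - q.1)) (rnorm (p.2 - q.2)).
Proof. by rewrite -rnorm_pair; congr rnorm. Qed.

Lemma closure_pairP (A : set (V * W)) x y :
  closure A (x, y) <-> forall e : R, 0 < e -> exists x' y',
    [/\ A (x', y'), rnorm (x - x') < e & rnorm (y - y') < e].
Proof.
split=> [/rnorm_closureP cA e e0|cA].
  have [[x' y'] Axy] := cA e e0; rewrite rnorm_pair gt_max => /andP[? ?].
  by exists x', y'.
apply/rnorm_closureP => e /cA[x' [y' [Axy xe ye]]].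
by exists (x', y') => //; rewrite rnorm_pair gt_max xe.
Qed.

End Pairs.

(** Completeness tested only on geometrically fast sequences, the ones that successive approximation
    produces. In this form it passes to products coordinatewise, and it holds for [R[i]^o]; both
    occur below as spaces of unknowns. *)
Definition geo_complete (Z : normedModType R[i]) :=
  forall (u : nat -> Z) (C : R),
    (forall n, rnorm (u n.+1 - u n) <= C * 2^-1 ^+ n) ->
    exists l, forall e : R, 0 < e ->
      exists N, forall n, (N <= n)%N -> rnorm (l - u n) < e.

(** The factor [1 - 2^-1 ^+ k] is kept because the induction on [k] does not close with the weaker
    bound without it. *)
Lemma geo_tail (Z : normedModType R[i]) (u : nat -> Z) (C : R) :
  (forall n, rnorm (u n.+1 - u n) <= C * 2^-1 ^+ n) ->
  forall n k, rnorm (u (n + k)%N - u n) <= 2 * C * 2^-1 ^+ n * (1 - 2^-1 ^+ k).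
Proof.
move=> uC n; elim=> [|k IH]; first by rewrite addn0 subrr rnorm0 expr0 subrr mulr0.
apply: (le_trans (rnorm_triangle (u (n + k)%N) _ _)).
rewrite addnS; have := lerD (uC (n + k)%N) IH; move/le_trans; apply.
by rewrite exprD exprS; lra.
Qed.

Lemma half_pow_lt (e : R) : 0 < e -> exists n, 2^-1 ^+ n < e.
Proof.
move=> e0; have h1 : `|2^-1 : R| < 1 by rewrite ger0_norm; lra.
have [n _ /(_ n (leqnn n)) /=] := ((cvgrPdist_lt _ _).1 (cvg_expr h1)) e e0.
by rewrite sub0r normrN ger0_norm ?exprn_ge0//; exists n.
Qed.

Lemma half_pow_mul_lt (C e : R) : 0 < e -> exists n, C * 2^-1 ^+ n < e.
Proof.
move=> e0; have [C0|C0] := leP C 0.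
  by exists 0%N; rewrite expr0 mulr1 (le_lt_trans C0).
have [n ne] := @half_pow_lt (e / C) (divr_gt0 e0 C0).
by exists n; rewrite mulrC -ltr_pdivlMr.
Qed.

Lemma geo_C_ge0 (Z : normedModType R[i]) (u : nat -> Z) (C : R) :
  (forall n, rnorm (u n.+1 - u n) <= C * 2^-1 ^+ n) -> 0 <= C.
Proof. by move=> /(_ 0%N); rewrite expr0 mulr1 => /(le_trans (rnorm_ge0 _)). Qed.

Lemma geo_complete_completeNormedMod (X : completeNormedModType R[i]) :
  geo_complete X.
Proof.
move=> u C uC; have C0 := geo_C_ge0 uC.
have tail n k : rnorm (u (n + k)%N - u n) <= 2 * C * 2^-1 ^+ n.
  apply: (le_trans (geo_tail uC n k)); have p0 : 0 <= 2^-1 ^+ k :> R by rewrite exprn_ge0.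
  by rewrite ler_piMr ?mulr_ge0 ?exprn_ge0//; lra.
have uc : cvg (u n @[n --> \oo]).
  apply/cauchy_cvgP/cauchy_exP => e e0.
  have er : e = (complex.Re e)%:C by rewrite RRe_real// gtr0_real.
  have [n ne] := @half_pow_mul_lt (2 * C) (complex.Re e) ltac:(by rewrite -ltcR -er).
  exists (u n); exists n => // m /= nm.
  rewrite -ball_normE /= -rnormE er ltcR rnorm_distC -(subnKC nm).
  exact: le_lt_trans (tail _ _) ne.
exists (lim (u n @[n --> \oo])) => e e0.
have eC : 0 < e%:C :> R[i] by rewrite ltcR.
have [N _ uN] := ((cvgrPdist_lt _ _).1 uc) _ eC.
by exists N => n /uN; rewrite -rnormE ltcR.
Qed.

Lemma geo_limit_le (Z : normedModType R[i]) (u : nat -> Z) (C : R) (l : Z) :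
  (forall n, rnorm (u n.+1 - u n) <= C * 2^-1 ^+ n) ->
  (forall e : R, 0 < e -> exists N, forall n, (N <= n)%N -> rnorm (l - u n) < e) ->
  forall n, rnorm (l - u n) <= 2 * C * 2^-1 ^+ n.
Proof.
move=> uC ul n; have C0 := geo_C_ge0 uC; apply/ler_addgt0Pr => e /ul[N uN].
rewrite [leRHS]addrC; apply: le_trans (rnorm_triangle (u (n + N)%N) _ _) _.
apply: lerD; first exact/ltW/uN/leq_addl.
apply: (le_trans (geo_tail uC n N)).
have p0 : 0 <= 2^-1 ^+ N :> R by rewrite exprn_ge0.
by rewrite ler_piMr ?mulr_ge0 ?exprn_ge0//; lra.
Qed.

Lemma geo_complete_prod (Z1 Z2 : normedModType R[i]) :
  geo_complete Z1 -> geo_complete Z2 -> geo_complete (Z1 * Z2)%type.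
Proof.
move=> c1 c2 u C uC.

have [l1 u1] := c1 (fun n => (u n).1) C
  ltac:(by move=> n; have := uC n; rewrite rnorm_pairB ge_max => /andP[]).
have [l2 u2] := c2 (fun n => (u n).2) C
  ltac:(by move=> n; have := uC n; rewrite rnorm_pairB ge_max => /andP[]).
exists (l1, l2) => e e0; have [N1 un1] := u1 e e0; have [N2 un2] := u2 e e0.
exists (maxn N1 N2) => n; rewrite geq_max => /andP[n1 n2].
by rewrite rnorm_pairB gt_max un1// un2.
Qed.

Lemma rnormc_Re (z : R[i]^o) : `|complex.Re z| <= rnorm z.
Proof.
rewrite /rnorm normc_def /= -(sqrtr_sqr (complex.Re z)) ler_wsqrtr//.
by rewrite lerDl sqr_ge0.
Qed.

Lemma rnormc_Im (z : R[i]^o) : `|complex.Im z| <= rnorm z.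
Proof.
rewrite /rnorm normc_def /= -(sqrtr_sqr (complex.Im z)) ler_wsqrtr//.
by rewrite lerDr sqr_ge0.
Qed.

Lemma rnormc_le (z : R[i]^o) : rnorm z <= `|complex.Re z| + `|complex.Im z|.
Proof.
rewrite /rnorm normc_def /= -(@ler_pXn2r _ 2) ?nnegrE ?sqrtr_ge0 ?addr_ge0//.
rewrite sqr_sqrtr ?addr_ge0 ?sqr_ge0// sqrrD !real_normK ?num_real//.
by rewrite lerD2r lerDl mulrn_wge0 ?mulr_ge0.
Qed.

(* [u n - 2C/2^n] is nondecreasing and stays below the nonincreasing
   [u n + 2C/2^n], so its supremum is the limit. *)
Lemma geo_cvg_real (u : nat -> R) (C : R) :
  (forall n, `|u n.+1 - u n| <= C * 2^-1 ^+ n) ->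
  exists l, forall n, `|l - u n| <= 2 * C * 2^-1 ^+ n.
Proof.
move=> uC.
have C0 : 0 <= C by have := uC 0%N; rewrite expr0 mulr1 => /(le_trans (normr_ge0 _)).
pose v n := u n - 2 * C * 2^-1 ^+ n; pose w n := u n + 2 * C * 2^-1 ^+ n.
have vS n : v n <= v n.+1.
  by have := uC n; rewrite /v exprS ler_norml => /andP[]; lra.
have wS n : w n.+1 <= w n.
  by have := uC n; rewrite /w exprS ler_norml => /andP[]; lra.
have vm m n : (m <= n)%N -> v m <= v n by apply: (homo_leq lexx le_trans).
have wm m n : (m <= n)%N -> w n <= w m.
  by apply: (@homo_leq _ w (fun x y => y <= x)) => // y x z xy yz; exact: le_trans yz xy.
have vw m n : v m <= w n.
  apply: le_trans (vm _ _ (leq_maxl m n)) _; apply: le_trans _ (wm _ _ (leq_maxr m n)).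
  have : 0 <= C * 2^-1 ^+ maxn m n by rewrite mulr_ge0// exprn_ge0.
  by rewrite /v /w; lra.
have hs : has_sup (range v).
  by split; [exists (v 0%N), 0%N | exists (w 0%N) => _ [n _ <-]].
exists (sup (range v)) => n; rewrite ler_norml; apply/andP; split.
  have : v n <= sup (range v) by apply: ub_le_sup; [case: hs | exists n].
  by rewrite /v; lra.
have : sup (range v) <= w n by apply: ge_sup; [case: hs | move=> _ [m _ <-]].
by rewrite /w; lra.
Qed.

Lemma geo_complete_complex : geo_complete (R[i]^o : normedModType R[i]).
Proof.
move=> u C uC.
have uRe n : `|complex.Re (u n.+1) - complex.Re (u n)| <= C * 2^-1 ^+ n.
  by rewrite -raddfB; apply: le_trans (rnormc_Re _) (uC n).
have uIm n : `|complex.Im (u n.+1) - complex.Im (u n)| <= C * 2^-1 ^+ n.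
  by rewrite -raddfB; apply: le_trans (rnormc_Im _) (uC n).
have [a ua] := geo_cvg_real uRe; have [b ub] := geo_cvg_real uIm.
exists (a +i* b) => e e0.
(* The real and the imaginary part each contribute an error of at most [2 * C * 2^-1 ^+ n]. *)
have [N Ne] := @half_pow_mul_lt (4 * C) e e0.
exists N => n Nn; apply: le_lt_trans (rnormc_le _) _.
rewrite !raddfB /=; apply: le_lt_trans (lerD (ua n) (ub n)) _.
apply: le_lt_trans _ Ne.
have : C * 2^-1 ^+ n <= C * 2^-1 ^+ N.
  rewrite ler_wpM2l// ?(geo_C_ge0 uC)// ler_wiXn2l//; lra.
by lra.
Qed.

End RealNorm.

(** * Successive approximation *)

Section SubspaceOps.
Context {K : fieldType} {V : lmodType K}.
Implicit Type M : vsubspace V.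

Lemma vs_setD M x y : vs_set M x -> vs_set M y -> vs_set M (x + y).
Proof. by move=> Mx My; rewrite -[x]scale1r; exact: vs_lin. Qed.

Lemma vs_setN M x : vs_set M x -> vs_set M (- x).
Proof. by rewrite -scaleN1r; exact: vs_setZ. Qed.

Lemma vs_setB M x y : vs_set M x -> vs_set M y -> vs_set M (x - y).
Proof. by move=> Mx /vs_setN; exact: vs_setD. Qed.

Lemma vs_set_sum M n (c : 'I_n -> K) (f : 'I_n -> V) :
  (forall i, vs_set M (f i)) -> vs_set M (\sum_i c i *: f i).
Proof.
by move=> Mf; apply: (big_ind (vs_set M)) => [|x y|i _];
  [exact: (vs_set0 M)|exact: vs_setD|exact: vs_setZ].
Qed.

(** The subspace [M + span f]. Finite spans are the case [M = 0], so that closedness and coefficient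
    bounds are proved once for both. *)
Fact vs_addspan_subspace M n (f : 'I_n -> V) :
  is_subspace [set v | exists c : 'I_n -> K, vs_set M (v - \sum_i c i *: f i)].
Proof.
split.
  exists (fun=> 0); rewrite big1 ?subr0 => [|i _]; first exact: (vs_set0 M).
  by rewrite scale0r.
move=> a u v [c Mc] [d Md]; exists (fun i => a * c i + d i).
rewrite (_ : _ - _ = a *: (u - \sum_i c i *: f i) + (v - \sum_i d i *: f i)).
  exact: vs_lin.
rewrite scalerBr addrACA -opprD; congr (_ - _).
rewrite scaler_sumr -big_split; apply: eq_bigr => i _.
by rewrite scalerDl scalerA.
Qed.
Definition vs_addspan M n (f : 'I_n -> V) := VSubspace (vs_addspan_subspace M f).

Fact vs_zero_subspace : is_subspace [set 0 : V].
Proof. by split=> // a u v /= -> ->; rewrite scaler0 addr0. Qed.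
Definition vs_zero := VSubspace vs_zero_subspace.

Fact vs_full_subspace : is_subspace [set: V].
Proof. by []. Qed.
Definition vs_full := VSubspace vs_full_subspace.

Definition vs_span n (f : 'I_n -> V) := vs_addspan vs_zero f.

Lemma vs_spanP n (f : 'I_n -> V) v :
  vs_set (vs_span f) v <-> exists c : 'I_n -> K, v = \sum_i c i *: f i.
Proof.
split=> [[c /= /eqP]|[c ->]]; first by rewrite subr_eq0 => /eqP ->; exists c.
by exists c; rewrite /= subrr.
Qed.

Lemma vs_span_sum n (f : 'I_n -> V) (c : 'I_n -> K) :
  vs_set (vs_span f) (\sum_i c i *: f i).
Proof. by apply/vs_spanP; exists c. Qed.

Lemma sum_delta n (f : 'I_n -> V) i : \sum_j (j == i)%:R *: f j = f i.
Proof.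
rewrite (bigD1 i)//= eqxx scale1r big1 ?addr0// => j /negbTE ->.
by rewrite scale0r.
Qed.

Lemma vs_span_mem n (f : 'I_n -> V) i : vs_set (vs_span f) (f i).
Proof. by rewrite -(sum_delta f i); exact: vs_span_sum. Qed.

End SubspaceOps.

Lemma lr_ranP (K : fieldType) (Z X : lmodType K) (T : linrel Z X) y :
  vs_set (lr_ran T) y <-> exists x, vs_set T (x, y).
Proof.
split=> [[x _ Txy]|[x Txy]]; first by exists x.
by exists x => //; exists y.
Qed.

Section GraphOps.
Context {K : fieldType} {Z V : lmodType K}.
Implicit Type H : linrel Z V.

Lemma graphD H z y z' y' : vs_set H (z, y) -> vs_set H (z', y') ->
  vs_set H (z + z', y + y').
Proof. exact: (@vs_setD _ _ H (z, y) (z', y')). Qed.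

Lemma graphB H z y z' y' : vs_set H (z, y) -> vs_set H (z', y') ->
  vs_set H (z - z', y - y').
Proof. exact: (@vs_setB _ _ H (z, y) (z', y')). Qed.

Lemma graphZ H a z y : vs_set H (z, y) -> vs_set H (a *: z, a *: y).
Proof. exact: (@vs_setZ _ _ H a (z, y)). Qed.

Lemma graph_sum H n (c : 'I_n -> K) (z : 'I_n -> Z) (y : 'I_n -> V) :
  (forall i, vs_set H (z i, y i)) ->
  vs_set H (\sum_i c i *: z i, \sum_i c i *: y i).
Proof.
move=> Hzy; apply: (big_ind2 (fun z y => vs_set H (z, y))) => [||i _].
- exact: (vs_set0 H).
- by move=> *; exact: graphD.
- exact: graphZ.
Qed.

End GraphOps.

Section Iteration.
Context {R : realType}.
Local Open Scope complex_scope.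

(* Successive approximation: the errors are halved at every step, so the
   approximate solutions sum up to an exact one. *)
Lemma iterated_approximation (Z V : normedModType R[i]) (H : linrel Z V)
    (W : vsubspace V) (C : R) : geo_complete Z ->
  (forall y, vs_set W y -> rnorm y <= 1 -> exists z w,
    [/\ vs_set H (z, w), rnorm z <= C, vs_set W (y - w) & rnorm (y - w) <= 2^-1]) ->
  forall y, vs_set W y -> exists2 z,
    rnorm z <= 2 * C * rnorm y & closure (vs_set H) (z, y).
Proof.
move=> cZ HW.
suff unit y : vs_set W y -> rnorm y <= 1 ->
    exists2 z, rnorm z <= 2 * C & closure (vs_set H) (z, y).
  move=> y Wy; have [->|y0] := eqVneq y 0.
    exists 0; first by rewrite !rnorm0 mulr0.
    exact: (vs_set0 (vs_closure H)).
  have [|z zC Hz] := unit ((rnorm y)^-1%:C *: y) (vs_setZ _ Wy).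
    by rewrite rnorm_normalize.
  have p := rnorm_gt0 y0.
  exists ((rnorm y)%:C *: z).
    by rewrite rnorm_scale ?rnorm_ge0// mulrC ler_wpM2r// ltW.
  have yE : (rnorm y)%:C *: ((rnorm y)^-1%:C *: y) = y.
    rewrite scalerA -(rmorphM (real_complex R)) mulfV ?gt_eqF//.
    by rewrite scale1r.
  rewrite -[X in (_, X)]yE.
  exact: (@vs_setZ _ _ (vs_closure H) (rnorm y)%:C (z, _)).
move=> Wy y1.
have /choice[f fP] : forall v : V, exists p : Z * V,
    vs_set W v -> rnorm v <= 1 ->
    [/\ vs_set H p, rnorm p.1 <= C, vs_set W (v - p.2) & rnorm (v - p.2) <= 2^-1].
  move=> v; have [[Wv v1]|nv] := pselect (vs_set W v /\ rnorm v <= 1).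
    by have [z [w ?]] := HW v Wv v1; exists (z, w).
  by exists 0 => Wv v1; case: nv.
(* [v n] is the residual after [n] corrections, multiplied by [2 ^ n], which keeps it in the unit
   ball of [W]. The corrections weighted by [q k] add up to a solution for [y - q n *: v n]. *)
pose v := fix v n := if n is m.+1 then (2 : R)%:C *: (v m - (f (v m)).2) else y.
have vP n : vs_set W (v n) /\ rnorm (v n) <= 1.
  elim: n => [//|n [Wn n1]] /=; have [_ _ Wf fn] := fP _ Wn n1.
  by split; [exact: vs_setZ | rewrite rnorm_scale//; lra].
have fvP n : [/\ vs_set H (f (v n)), rnorm (f (v n)).1 <= C,
    vs_set W (v n - (f (v n)).2) & rnorm (v n - (f (v n)).2) <= 2^-1].
  by have [] := vP n; exact: fP.
pose q n : R[i] := (2^-1 ^+ n)%:C.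
pose zeta n := \sum_(k < n) q k *: (f (v k)).1.
have Hz n : vs_set H (zeta n, y - q n *: v n).
  elim: n => [|n IH].
    rewrite /zeta big_ord0 /q expr0 /= scale1r subrr; exact: (vs_set0 H).
  rewrite /zeta big_ord_recr /= addrC.
  have -> : y - q n.+1 *: v n.+1 = q n *: (f (v n)).2 + (y - q n *: v n).
    rewrite /= scalerA -(rmorphM (real_complex R)) exprSr -mulrA mulVf// mulr1.
    by rewrite scalerBr opprB addrCA addrC -addrA; congr (_ + _); rewrite addrC.
  by apply: (lr_val_lin _ _ IH); case: (fvP n) => + _ _ _; case: (f (v n)).
have zetaC n : rnorm (zeta n.+1 - zeta n) <= C * 2^-1 ^+ n.
  rewrite /zeta big_ord_recr /= [_ - _]addrC addKr rnorm_scale ?exprn_ge0// mulrC.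
  by rewrite ler_wpM2r ?exprn_ge0//; case: (fvP n).
have [z zl] := cZ _ _ zetaC; exists z.
  have := geo_limit_le zetaC zl 0.
  by rewrite /zeta big_ord0 subr0 expr0 mulr1.
apply/closure_pairP => e e0; have [N zN] := zl e e0; have [M Me] := half_pow_lt e0.
exists (zeta (N + M)%N), (y - q (N + M)%N *: v (N + M)%N); split; [exact: Hz| |].
  by apply: zN; rewrite leq_addr.
rewrite opprB addrCA subrr addr0 rnorm_scale ?exprn_ge0//.
apply: le_lt_trans _ Me; apply: (@le_trans _ _ (2^-1 ^+ (N + M) * 1)).
  by rewrite ler_wpM2l ?exprn_ge0//; case: (vP (N + M)%N).
rewrite mulr1 exprD ler_piMl ?exprn_ge0// exprn_ile1//; lra.
Qed.

(** A point of the unit ball of the closed range is within 1/2 of some [w] in the range with norm at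
    most 2, hence with a preimage of norm at most [2 * C]; iteration doubles this constant once
    more. Since [H] need not be closed, the solution lies in the closure of its graph. *)
Lemma closure_bounded_solve (Z V : normedModType R[i]) (H : linrel Z V) (C : R) :
  geo_complete Z -> 0 <= C ->
  (forall z y, vs_set H (z, y) ->
    exists2 z', vs_set H (z', y) & rnorm z' <= C * rnorm y) ->
  forall y, closure (vs_set (lr_ran H)) y ->
  exists2 z, rnorm z <= 4 * C * rnorm y & closure (vs_set H) (z, y).
Proof.
move=> cZ C0 HC y Hy.
have [||z zC zH] := @iterated_approximation _ _ H (vs_closure (lr_ran H)) (2 * C) cZ _ y.
- move=> {Hy}y Hy y1.
  have [w /lr_ranP[z0 Hz0] yw] := (rnorm_closureP _ _).1 Hy 2^-1 ltac:(lra).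
  have [z Hz zC] := HC _ _ Hz0; exists z, w; split => //; last exact: ltW.
    have w2 : rnorm w <= 2.
      have := rnormB (y - w) y; rewrite addrAC subrr add0r rnormN.
      move/le_trans; apply; lra.
    by apply: le_trans zC _; rewrite mulrC ler_wpM2r.
  apply: (@vs_setB _ _ (vs_closure (lr_ran H))) => //.
  by apply: subset_closure; apply/lr_ranP; exists z.
- exact: Hy.
- exists z => //; apply: le_trans zC _; rewrite le_eqVlt; apply/orP; left; apply/eqP.
  by ring.
Qed.

Lemma closed_ran_bounded_solve (Z V : normedModType R[i]) (H : linrel Z V) (C : R) :
  geo_complete Z -> 0 <= C -> closed (vs_set H) ->
  (forall z y, vs_set H (z, y) ->
    exists2 z', vs_set H (z', y) & rnorm z' <= C * rnorm y) ->
  closed (vs_set (lr_ran H)).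
Proof.
move=> cZ C0 cH HC y Hy; have [z _ zH] := closure_bounded_solve cZ C0 HC Hy.
by apply/lr_ranP; exists z; exact: cH.
Qed.

End Iteration.

(** * Finite-dimensional subspaces and open mapping *)

Section FiniteDimensional.
Context {R : realType}.
Local Open Scope complex_scope.
Implicit Types V Z : normedModType R[i].

(** [d] bounds the distance from [k] to the closed subspace [M] from below. Dividing by [c] puts
    [k - c^-1 *: v] in [M], so that [c^-1 *: v] has norm at least [d]. *)
Lemma coef_bound V (M : vsubspace V) (k : V) : closed (vs_set M) -> ~ vs_set M k ->
  exists2 d : R, 0 < d & forall v (c : R[i]^o), vs_set M (v - c *: k) ->
    rnorm c * d <= rnorm v.
Proof.
move=> cM nMk.
have [d d0 dM] : exists2 d : R, 0 < d & forall m, vs_set M m -> d <= rnorm (k - m).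
  apply: contrapT => H; apply: nMk; apply: (rnorm_closed cM) => e e0.
  apply: contrapT => H'; apply: H; exists e => // m Mm.
  by rewrite leNgt; apply/negP => me; apply: H'; exists m.
exists d => // v c Mv; have [->|c0] := eqVneq c 0.
  by rewrite rnorm0 mul0r rnorm_ge0.
have {}Mv : vs_set M (k - c^-1 *: v).
  have := vs_setZ (- c^-1) Mv.
  by rewrite scalerBr scalerA mulNr mulVf// !scaleNr opprK scale1r addrC.
have := dM _ Mv; rewrite opprB addrCA subrr addr0 rnormZ.
have -> : complex.Re `|c^-1| = (rnorm c)^-1.
  apply: complexI; rewrite RRe_real ?ger0_real// normfV.
  by rewrite (fmorphV (real_complex R)) /= rnormE.
by rewrite ler_pdivlMl// rnorm_gt0.
Qed.

(** If [k] is outside [M], the subspace is the range of the closed relation formed by the [(c, v)]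
    with [v - c *: k] in [M], and [coef_bound] solves this relation for [c] with a bound. *)
Lemma closed_addline V (M : vsubspace V) (k : V) : closed (vs_set M) ->
  closed [set v | exists c : R[i], vs_set M (v - c *: k)].
Proof.
move=> cM; have [Mk|nMk] := pselect (vs_set M k).
  have -> : [set v | exists c : R[i], vs_set M (v - c *: k)] = vs_set M => //.
  apply/seteqP; split=> v /= => [[c Mv]|Mv].
    by rewrite -(subrK (c *: k) v); apply: vs_setD => //; exact: vs_setZ.
  by exists 0; rewrite scale0r subr0.
have [d d0 dM] := coef_bound cM nMk.
have Hs : is_subspace [set p : R[i]^o * V | vs_set M (p.2 - p.1 *: k)].
  split; first by rewrite /= scale0r subr0; exact: vs_set0.
  move=> a [c u] [c' u'] /= Mu Mu'.
  rewrite scalerDl -[(_ *: c) *: k]/((a * c) *: k) opprD addrACA -scalerA -scalerBr.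
  exact: vs_lin.
pose H : linrel (R[i]^o) V := VSubspace Hs.
have -> : [set v | exists c : R[i], vs_set M (v - c *: k)] = vs_set (lr_ran H).
  by apply/seteqP; split=> v /= => [Hv|/lr_ranP//]; apply/lr_ranP.
apply: (@closed_ran_bounded_solve _ _ _ _ d^-1).
- exact: geo_complete_complex.
- by rewrite invr_ge0 ltW.
- move=> [c v] /closure_pairP Hcv; rewrite /= .
  apply: (rnorm_closed cM) => e e0.
  have k0 : 0 < 1 + rnorm k by rewrite ltr_pwDl ?rnorm_ge0.
  have [c' [v' [/= Mv' cc' vv']]] := Hcv _ (divr_gt0 e0 k0).
  exists (v' - c' *: k) => //.
  have -> : v - c *: k - (v' - c' *: k) = (v - v') - (c - c') *: k.
    by rewrite scalerBl !opprB addrACA [RHS]addrACA; congr (_ + _); rewrite addrC.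
  apply: le_lt_trans (rnormB _ _) _; rewrite rnormZ.
  apply: (@lt_le_trans _ _ (e / (1 + rnorm k) + e / (1 + rnorm k) * rnorm k)).
    by rewrite ltr_leD// ler_wpM2r ?rnorm_ge0// ltW.
  by rewrite -{1}[e / _]mulr1 -mulrDr divfK// gt_eqF.
- move=> c v Mv; exists c => //.
  by rewrite mulrC ler_pdivlMr//; exact: dM.
Qed.

Lemma closed_addspan V (M : vsubspace V) n (f : 'I_n -> V) : closed (vs_set M) ->
  closed (vs_set (vs_addspan M f)).
Proof.
move=> cM; elim: n => [|n IH] in f *.
  have -> // : vs_set (vs_addspan M f) = vs_set M.
  apply/seteqP; split=> v /= => [[c]|Mv]; first by rewrite big_ord0 subr0.
  by exists (fun=> 0); rewrite big_ord0 subr0.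
have := @closed_addline _ _ (f ord_max) (IH (f \o widen_ord (leqnSn n))).
set A := [set _ | _]; set B := vs_set _; suff -> : A = B by [].
rewrite {}/A {}/B; apply/seteqP; split=> v /= => [[c [d Md]]|[c Mc]].
  (* [insub] fails exactly at the last index, which receives the new coefficient [c]; the others
     keep their value under [d]. *)
  exists (fun i => oapp d c (insub (i : nat))).
  rewrite big_ord_recr /= insubF ?ltnn//= opprD addrA addrAC.
  congr vs_set : Md; congr (_ - _); apply: eq_bigr => i _.
  by rewrite (insubT (fun k => k < n)%N (ltn_ord i)) /=; congr (d _ *: _); exact: val_inj.
exists (c ord_max), (c \o widen_ord (leqnSn n)).
by move: Mc; rewrite big_ord_recr /= opprD addrA addrAC.
Qed.

Lemma closed_vs_zero V : closed (vs_set (@vs_zero _ V)).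
Proof.
apply: closed_rnorm => x Hx; apply: rnorm_small_eq0 => e /Hx[y /= ->].
by rewrite subr0.
Qed.

Lemma closed_span V n (f : 'I_n -> V) : closed (vs_set (vs_span f)).
Proof. exact/closed_addspan/closed_vs_zero. Qed.

(** Linear independence of the classes in [V / M], expressed in [V] itself; [M = vs_zero] gives
    ordinary independence. *)
Definition free_mod (K : fieldType) (V : lmodType K) (M : vsubspace V) n (f : 'I_n -> V) :=
  forall c : 'I_n -> K, vs_set M (\sum_i c i *: f i) -> forall i, c i = 0.

(** The [i]-th coefficient is controlled by [coef_bound] for the closed subspace spanned by [M] and
    the other vectors. The family [g i] replaces [f i] by 0, which removes it without changing the
    index type. *)
Lemma coefs_bound V (M : vsubspace V) n (f : 'I_n -> V) : closed (vs_set M) ->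
  free_mod M f -> exists2 k : R, 0 <= k &
    forall v (c : 'I_n -> R[i]^o), vs_set M (v - \sum_i c i *: f i) ->
    forall i, rnorm (c i) <= k * rnorm v.
Proof.
move=> cM fM.
pose g (i j : 'I_n) := if j == i then 0 else f j.
have sumg i (c : 'I_n -> R[i]) : \sum_j c j *: f j = \sum_j c j *: g i j + c i *: f i.
  have gi : g i i = 0 by rewrite /g eqxx.
  rewrite (bigD1 i)//= [in RHS](bigD1 i)//= gi scaler0 add0r addrC.
  by congr (_ + _); apply: eq_bigr => j /negbTE ji; rewrite /g ji.
have /choice[d dP] : forall i, exists d : R, 0 < d /\ forall v (c : R[i]^o),
    vs_set (vs_addspan M (g i)) (v - c *: f i) -> rnorm c * d <= rnorm v.
  move=> i; have [||d d0 dM] := @coef_bound _ (vs_addspan M (g i)) (f i).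
  - exact: closed_addspan.
  - move=> [c Mc]; pose c' j := if j == i then 1 else - c j.
    have Mc' : vs_set M (\sum_j c' j *: f j).
      rewrite (sumg i) {2}/c' eqxx scale1r.
      congr vs_set : Mc; rewrite addrC; congr (_ + _).
      rewrite -sumrN; apply: eq_bigr => j _; rewrite /g /c'; case: eqP => _.
        by rewrite !scaler0 oppr0.
      by rewrite scaleNr.
    by have /eqP := fM c' Mc' i; rewrite /c' eqxx oner_eq0.
  - by exists d.
exists (\sum_i (d i)^-1); first by apply: sumr_ge0 => i _; rewrite invr_ge0 ltW//; case: (dP i).
move=> v c Mv i; have [di0 /(_ v (c i)) H] := dP i.
apply: (@le_trans _ _ ((d i)^-1 * rnorm v)).
  rewrite mulrC ler_pdivlMr//; apply: H; exists c.
  by rewrite -addrA -opprD [_ + \sum__ _]addrC -sumg.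
rewrite ler_wpM2r ?rnorm_ge0// (bigD1 i)//= lerDl sumr_ge0// => j _.
by rewrite invr_ge0 ltW//; case: (dP j).
Qed.

(** Total boundedness at the single scale [e]; the points of the net need not belong to [A]. *)
Definition has_net V (A : set V) (e : R) :=
  exists l : seq V, forall x, A x -> exists2 k, k \in l & rnorm (x - k) < e.

Lemma has_netS V (A B : set V) (e e' : R) : A `<=` B -> e <= e' ->
  has_net B e -> has_net A e'.
Proof.
move=> AB ee' [l Bl]; exists l => x /AB /Bl[k kl xk]; exists k => //.
exact: lt_le_trans xk ee'.
Qed.

Lemma has_netD V (A B : set V) (e e' : R) : has_net A e -> has_net B e' ->
  has_net [set x | exists a b, [/\ A a, B b & x = a + b]] (e + e').
Proof.
move=> [l Al] [m Bm]; exists [seq a + b | a <- l, b <- m].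
move=> _ [a [b [/Al[a' a'l aa'] /Bm[b' b'm bb'] ->]]].
exists (a' + b'); first by apply/allpairsP; exists (a', b').
by rewrite opprD addrACA (le_lt_trans (rnormD _ _))// ltrD.
Qed.

Lemma real_net (r e : R) : 0 < e ->
  exists l : seq R, forall x, `|x| <= r -> exists2 k, k \in l & `|x - k| < e.
Proof.
move=> e0; exists [seq - r + i%:R * e | i <- iota 0 (Num.truncn (2 * r / e)).+1].
move=> x; rewrite ler_norml => /andP[rx xr].
have q0 : 0 <= (x + r) / e by apply: divr_ge0; lra.
exists (- r + (Num.truncn ((x + r) / e))%:R * e).
  apply/mapP; exists (Num.truncn ((x + r) / e)) => //.
  rewrite mem_iota add0n ltnS; apply: le_truncn.
  by rewrite ler_pM2r ?invr_gt0//; lra.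
have /andP[] := truncn_itv q0; move: (Num.truncn _) => m.
rewrite ler_pdivlMr// ltr_pdivrMr// -natr1 mulrDl mul1r.
by move=> ? ?; rewrite ltr_norml; apply/andP; split; lra.
Qed.

Lemma disc_net (r e : R) : 0 < e -> has_net [set c : R[i]^o | rnorm c <= r] e.
Proof.
move=> e0; have [l lP] := @real_net r (e / 2) ltac:(lra).
exists [seq (a +i* b : R[i]^o) | a <- l, b <- l] => c /= cr.
have [a al ca] := lP _ (le_trans (rnormc_Re c) cr).
have [b bl cb] := lP _ (le_trans (rnormc_Im c) cr).
exists (a +i* b); first by apply/allpairsP; exists (a, b).
by apply: le_lt_trans (rnormc_le _) _; rewrite !raddfB /=; lra.
Qed.

Lemma line_net V (k : V) (r e : R) : 0 < e ->
  has_net [set v | exists2 c : R[i]^o, rnorm c <= r & v = c *: k] e.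
Proof.
move=> e0; have k0 : 0 < 1 + rnorm k by rewrite ltr_pwDl ?rnorm_ge0.
have [l lP] := @disc_net r (e / (1 + rnorm k)) (divr_gt0 e0 k0).
exists [seq c *: k | c : R[i]^o <- l] => _ [c cr ->].
have [c' c'l cc'] := lP c cr; exists (c' *: k); first exact: map_f.
rewrite -scalerBl rnormZ; apply: (@le_lt_trans _ _ (rnorm (c - c') * (1 + rnorm k))).
  by apply: ler_wpM2l; [exact: (rnorm_ge0 (c - c')) | lra].
by rewrite -ltr_pdivlMr.
Qed.

Lemma span_net V n (f : 'I_n -> V) (r e : R) : 0 < e ->
  has_net [set v | exists2 c : 'I_n -> R[i]^o,
    forall i, rnorm (c i) <= r & v = \sum_i c i *: f i] e.
Proof.
elim: n => [|n IH] in f e * => e0.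
  exists [:: 0] => _ [c _ ->]; exists 0; first by rewrite inE.
  by rewrite big_ord0 subrr rnorm0.
have e2 : 0 < e / 2 by lra.
have := has_netD (IH (f \o widen_ord (leqnSn n)) _ e2) (line_net (f ord_max) r e2).
rewrite -splitr; apply: has_netS => // _ [c cr ->].
exists (\sum_(i < n) c (widen_ord (leqnSn n) i) *: f (widen_ord (leqnSn n) i)).
exists (c ord_max *: f ord_max).
split; last by rewrite big_ord_recr.
  by exists (c \o widen_ord (leqnSn n)) => // i; exact: cr.
by exists (c ord_max).
Qed.

(** Independence makes the coefficients of a bounded vector bounded, which reduces the ball to a set
    covered by [span_net]. *)
Lemma ball_net V n (f : 'I_n -> V) (r e : R) : free_mod (@vs_zero _ V) f -> 0 < e ->
  has_net [set v | vs_set (vs_span f) v /\ rnorm v <= r] e.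
Proof.
move=> ff e0; have [k k0 kP] := coefs_bound (@closed_vs_zero V) ff.
apply: (has_netS _ (lexx e) (span_net f (k * r) e0)) => _ [/vs_spanP[c ->] cr].
exists c => // i; apply: le_trans (kP (\sum_i c i *: f i) c _ i) _; first by rewrite /= subrr.
by rewrite ler_wpM2l.
Qed.

End FiniteDimensional.

(** * The open mapping theorem for closed relations with closed range *)

Section OpenMapping.
Context {R : realType}.
Local Open Scope complex_scope.
Variables (Z V : normedModType R[i]) (H : linrel Z V).
Hypotheses (cZ : geo_complete Z) (cV : geo_complete V).
Hypotheses (cH : closed (vs_set H)) (cR : closed (vs_set (lr_ran H))).

(** The step of a gliding hump argument. If both [x + r y] and [x - r y] were within [r / 2] of
    images [w], [w'] of vectors of norm at most [n], then [(w - w') / (2 r)] would be within 1/2 of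
    [y] and be the image of a vector of norm at most [n / r]. So one of the two points can serve as
    [x']. *)
Lemma gliding_step (n : nat) (r : R) : 0 < r ->
  (exists2 y, vs_set (lr_ran H) y /\ rnorm y <= 1 & forall z w, vs_set H (z, w) ->
    rnorm z <= n%:R / r -> 2^-1 < rnorm (y - w)) ->
  forall x, vs_set (lr_ran H) x -> exists2 x', vs_set (lr_ran H) x' /\ rnorm (x' - x) <= r &
    forall z w, vs_set H (z, w) -> rnorm z <= n%:R -> r / 2 < rnorm (x' - w).
Proof.
move=> r0 [y [Ry y1] yP] x Rx; apply: contrapT => nx.
have r0' := ltW r0.
have side (s : bool) : exists z w, [/\ vs_set H (z, w), rnorm z <= n%:R &
    rnorm (x + (-1) ^+ s *: (r%:C *: y) - w) <= r / 2].
  apply: contrapT => ns; apply: nx; exists (x + (-1) ^+ s *: (r%:C *: y)).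
    split; first by apply: vs_setD => //; do 2 apply: vs_setZ.
    rewrite addrC addKr; have -> : rnorm ((-1) ^+ s *: (r%:C *: y)) = rnorm (r%:C *: y).
      by case: (s); rewrite ?scale1r// scaleN1r rnormN.
    by rewrite rnorm_scale// ler_piMr.
  move=> z w Hzw zn; rewrite ltNge; apply/negP => ?; apply: ns.
  by exists z, w.
have [z [w [Hzw zn xw]]] := side false; have [z' [w' [Hzw' zn' xw']]] := side true.
have i0 : 0 <= (2 * r)^-1 :> R by rewrite invr_ge0; lra.
have := yP _ _ (graphZ (2 * r)^-1%:C (graphB Hzw Hzw')).
rewrite rnorm_scale//; suff h1 : (2 * r)^-1 * rnorm (z - z') <= n%:R / r.
  move=> /(_ h1); rewrite ltNge => /negP; apply.
  have -> : y - (2 * r)^-1%:C *: (w - w') =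
      (2 * r)^-1%:C *: ((x + (-1) ^+ false *: (r%:C *: y) - w) -
                        (x + (-1) ^+ true *: (r%:C *: y) - w')).
    rewrite expr0 scale1r expr1 scaleN1r.
    have -> : (x + r%:C *: y - w) - (x - r%:C *: y - w') = (r%:C *: y + r%:C *: y) - (w - w').
      rewrite !opprD !opprK [LHS](AC (3*3) ((1*4)*((2*5)*(3*6)))) /=.
      by rewrite subrr add0r.
    rewrite [RHS]scalerBr -scalerDl -(rmorphD (real_complex R)) scalerA.
    rewrite -(rmorphM (real_complex R)).
    have -> : (2 * r)^-1 * (r + r) = 1 by field; lra.
    by rewrite scale1r.
  rewrite rnorm_scale//; apply: (@le_trans _ _ ((2 * r)^-1 * r)).
    rewrite ler_wpM2l//; apply: le_trans (rnormB _ _) _; lra.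
  by rewrite invfM -mulrA mulVf ?mulr1// gt_eqF.
rewrite invfM mulrAC ler_wpM2r ?invr_ge0// ler_pdivrMl//.
by apply: le_trans (rnormB _ _) _; lra.
Qed.

(** Were there no such [C], the gliding steps would produce a Cauchy sequence in the range. Its
    limit has a preimage [z], and stage [n] with [n] at least the norm of [z] excludes this. *)
Lemma approximate_solve : exists2 C : R, 0 < C & forall y,
  vs_set (lr_ran H) y -> rnorm y <= 1 -> exists z w,
    [/\ vs_set H (z, w), rnorm z <= C & rnorm (y - w) <= 2^-1].
Proof.
apply: contrapT => nC.
(* The ratio 1/8 makes the limit differ from [x n.+1] by at most [2 * r n.+1 = r n / 4], which is
   below the gap [r n / 2] created at stage [n]. *)
pose r n : R := 8^-1 ^+ n.
have r0 n : 0 < r n by rewrite exprn_gt0//; lra.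
have /choice[f fP] : forall p : nat * V, exists x', vs_set (lr_ran H) p.2 ->
    [/\ vs_set (lr_ran H) x', rnorm (x' - p.2) <= r p.1 &
      forall z w, vs_set H (z, w) -> rnorm z <= p.1%:R -> r p.1 / 2 < rnorm (x' - w)].
  move=> [n x] /=; have [Rx|nx] := pselect (vs_set (lr_ran H) x); last by exists 0.
  have [||x' [Rx' x'x] xP] := @gliding_step n (r n) (r0 n) _ x => //; last by exists x'.
  (* The successor keeps the constant positive for [n = 0]. *)
  apply: contrapT => ny; apply: nC; exists (n.+1%:R / r n); first by rewrite divr_gt0.
  move=> y Ry y1; apply: contrapT => nz; apply: ny; exists y => // z w Hzw zn.
  rewrite ltNge; apply/negP => yw; apply: nz; exists z, w; split => //.
  by apply: le_trans zn _; rewrite ler_pM2r ?invr_gt0// ler_nat.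
pose x := fix x n := if n is m.+1 then f (m, x m) else 0.
have Rx n : vs_set (lr_ran H) (x n).
  by elim: n => [|n IH]; [exact: (vs_set0 (lr_ran H)) | case: (fP (n, x n) IH)].
have xr n : rnorm (x n.+1 - x n) <= r n by case: (fP (n, x n) (Rx n)).
have xc n : rnorm (x n.+1 - x n) <= 1 * 2^-1 ^+ n.
  apply: le_trans (xr n) _; rewrite mul1r; apply: lerXn2r; rewrite ?nnegrE; lra.
have [l xl] := cV xc.
have Rl : vs_set (lr_ran H) l.
  apply: (rnorm_closed cR) => e /xl[N xN].
  by exists (x N) => //; exact: xN.
have [z Hzl] := (lr_ranP _ _).1 Rl.
have [n zn] : exists n, rnorm z <= n%:R.
  by exists (Num.truncn (rnorm z)).+1; exact/ltW/truncnS_gt.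
have [_ _ /(_ _ _ Hzl zn) /=] := fP (n, x n) (Rx n).
rewrite ltNge => /negP; apply.
have xck k : rnorm (x (n.+1 + k.+1)%N - x (n.+1 + k)%N) <= r n.+1 * 2^-1 ^+ k.
  rewrite addnS; apply: le_trans (xr _) _; rewrite /r exprD.
  apply: ler_wpM2l; first by apply: exprn_ge0; lra.
  by apply: lerXn2r; rewrite ?nnegrE; lra.
have /(_ 0%N) : forall k, rnorm (l - x (n.+1 + k)%N) <= 2 * r n.+1 * 2^-1 ^+ k.
  apply: (geo_limit_le xck) => e /xl[N xN]; exists N => k Nk.
  by apply: xN; rewrite (leq_trans Nk)// leq_addl.
rewrite addn0 expr0 mulr1 rnorm_distC => /le_trans; apply.
by rewrite /r exprS; have := r0 n; rewrite /r; lra.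
Qed.

Lemma open_mapping : exists2 C : R, 0 < C & forall y,
  vs_set (lr_ran H) y -> exists2 z, vs_set H (z, y) & rnorm z <= C * rnorm y.
Proof.
have [C C0 HC] := approximate_solve; exists (2 * C); first lra.
move=> y Ry; have [||z zC Hz] := @iterated_approximation _ _ _ H (lr_ran H) C cZ _ y.
- move=> {Ry}y Ry /(HC y Ry)[z [w [Hzw zC yw]]]; exists z, w; split => //.
  by apply: vs_setB => //; apply/lr_ranP; exists z.
- exact: Ry.
- by exists z => //; exact: cH.
Qed.
End OpenMapping.

(** * Dimensions *)

Section Dimension.
Context {K : fieldType}.
Implicit Types V : lmodType K.

(** With row vectors as coefficients, changes of family become matrix products, so that ranks,
    kernels and complements of matrices apply. *)
Definition rcomb V n (c : 'rV[K]_n) (f : 'I_n -> V) := \sum_i c 0 i *: f i.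

Lemma rcomb_mul V m n (c : 'rV[K]_m) (A : 'M[K]_(m, n)) (f : 'I_n -> V) :
  rcomb (c *m A) f = rcomb c (fun i => rcomb (row i A) f).
Proof.
rewrite /rcomb; under eq_bigr => j _ do rewrite mxE scaler_suml.
rewrite exchange_big; apply: eq_bigr => i _; rewrite scaler_sumr.
by apply: eq_bigr => j _; rewrite scalerA mxE.
Qed.

Lemma rcombB V n (c d : 'rV[K]_n) (f : 'I_n -> V) :
  rcomb (c - d) f = rcomb c f - rcomb d f.
Proof. by rewrite /rcomb -sumrB; apply: eq_bigr => i _; rewrite !mxE scalerBl. Qed.

Lemma rcombD V n (c d : 'rV[K]_n) (f : 'I_n -> V) :
  rcomb (c + d) f = rcomb c f + rcomb d f.
Proof. by rewrite /rcomb -big_split; apply: eq_bigr => i _; rewrite !mxE scalerDl. Qed.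

Lemma rcomb0 V n (f : 'I_n -> V) : rcomb 0 f = 0.
Proof. by rewrite /rcomb big1// => i _; rewrite mxE scale0r. Qed.

Lemma rcombE V n (c : 'I_n -> K) (f : 'I_n -> V) :
  \sum_i c i *: f i = rcomb (\row_i c i) f.
Proof. by apply: eq_bigr => i _; rewrite mxE. Qed.

Lemma rcomb_addspan V (M : vsubspace V) n (f : 'I_n -> V) v :
  vs_set (vs_addspan M f) v <-> exists c : 'rV[K]_n, vs_set M (v - rcomb c f).
Proof.
split=> [[c Mc]|[c Mc]]; first by exists (\row_i c i); rewrite -rcombE.
by exists (fun i => c 0 i).
Qed.

Lemma rcomb_span V n (f : 'I_n -> V) v :
  vs_set (vs_span f) v <-> exists c : 'rV[K]_n, v = rcomb c f.
Proof.
rewrite vs_spanP; split=> [[c ->]|[c ->]]; first by exists (\row_i c i); rewrite -rcombE.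
by exists (fun i => c 0 i).
Qed.

Lemma rcomb_free V (M : vsubspace V) n (f : 'I_n -> V) : free_mod M f <->
  forall c : 'rV[K]_n, vs_set M (rcomb c f) -> c = 0.
Proof.
split=> [fM c Mc|fM c].
  by apply/rowP => i; rewrite mxE; exact: (fM (fun j => c 0 j)).
by rewrite rcombE => /fM c0 i; have := congr1 (fun A : 'rV_n => A 0 i) c0; rewrite !mxE.
Qed.

Lemma basisP V n : has_basis_of_size V n <->
  exists e : 'I_n -> V, free_mod vs_zero e /\ forall v, vs_set (vs_span e) v.
Proof.
split=> [[e eP]|[e [fe ge]]]; exists e.
  split=> [c /= c0 i|v]; last first.
    by apply/vs_spanP; have [c [-> _]] := eP v; exists c.
  have [d [_ du]] := eP 0.
  have -> : c i = [ffun j => c j] i by rewrite ffunE.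
  rewrite -(du [ffun j => c j]).
    rewrite (du [ffun=> 0]) ?ffunE// big1// => j _.
    by rewrite ffunE scale0r.
  by rewrite -[LHS]c0; apply: eq_bigr => j _; rewrite ffunE.
move=> v; have [c ->] := (vs_spanP _ _).1 (ge v).
exists [ffun i => c i]; split; first by apply: eq_bigr => i _; rewrite ffunE.
move=> d cd; apply/ffunP => i; rewrite ffunE; apply/eqP; rewrite -subr_eq0; apply/eqP.
apply: (fe (fun j => c j - d j)) => /=.
under eq_bigr => j _ do rewrite scalerBl.
by rewrite sumrB cd subrr.
Qed.

(** Expanding each basis in the other gives matrices with [A *m B = 1], and the rank forces
    [n <= m]. *)
Lemma basis_size_le V n m : has_basis_of_size V n -> has_basis_of_size V m -> (n <= m)%N.
Proof.
move=> /basisP[e [fe ge]] /basisP[e' [_ ge']].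
have /choice[P eP] : forall i, exists c : 'rV[K]_m, e i = rcomb c e'.
  by move=> i; exact/rcomb_span.
have /choice[Q eQ] : forall j, exists c : 'rV[K]_n, e' j = rcomb c e.
  by move=> j; exact/rcomb_span.
pose A := \matrix_i P i; pose B := \matrix_j Q j.
apply: (@mulmx1_min _ _ _ A B); apply/row_matrixP => i; rewrite row_mul row1.
apply/eqP; rewrite -subr_eq0; apply/eqP.
apply: ((rcomb_free _ _).1 fe) => /=; rewrite rcombB rowK rcomb_mul.
have -> : (fun j => rcomb (row j B) e) = e'.
  by apply/funext => j; rewrite rowK -eQ.
rewrite -eP /rcomb; under eq_bigr => j _ do rewrite mxE eqxx /=.
by rewrite sum_delta subrr.
Qed.

Lemma basis_size_uniq V n m : has_basis_of_size V n -> has_basis_of_size V m -> n = m.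
Proof. by move=> ? ?; apply/eqP; rewrite eqn_leq !(@basis_size_le V). Qed.

Lemma vdim_basis V n : has_basis_of_size V n -> vdim V = n%:Z%:E.
Proof.
move=> Vn; rewrite /vdim; case: xgetP => [d dE [m Vm ->]|/(_ n%:Z%:E)[]].
  by rewrite (basis_size_uniq Vm Vn).
by exists n.
Qed.

Lemma vdim_lty V : (vdim V < +oo)%E -> exists n, has_basis_of_size V n.
Proof.
by rewrite /vdim; case: xgetP => [d dE [n Vn dn]|_]; [exists n | rewrite ltxx].
Qed.

(** A generating family of minimal size is independent: from a relation with [c i != 0] the vector
    [g i] could be eliminated. *)
Lemma fin_gen_basis V n (f : 'I_n -> V) : (forall v, vs_set (vs_span f) v) ->
  exists m, has_basis_of_size V m.
Proof.
pose P m := `[< exists g : 'I_m -> V, forall v, vs_set (vs_span g) v >].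
move=> gf; have exP : exists m, P m by exists n; apply/asboolP; exists f.
have [m Pm min_m] := ex_minnP exP; exists m; apply/basisP.
have [g gg] : exists g : 'I_m -> V, forall v, vs_set (vs_span g) v by exact/asboolP.
exists g; split=> // c /= c0 i; apply/eqP/negPn/negP => ci.
case: m => [|m] in g gg min_m Pm c c0 i ci *; first by case: i ci.
suff : P m by move=> /min_m; rewrite ltnn.
apply/asboolP; exists (g \o lift i) => v; apply/vs_spanP.
have [d ->] := (vs_spanP _ _).1 (gg v).
exists (fun j => d (lift i j) - d i / c i * c (lift i j)).
have : \sum_j (d j - d i / c i * c j) *: g j = \sum_j d j *: g j.
  under eq_bigr => j _ do rewrite scalerBl -scalerA.
  by rewrite sumrB -scaler_sumr c0 scaler0 subr0.
by move=> <-; rewrite (bigD1_ord i)//= divfK// subrr scale0r add0r.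
Qed.

Lemma val_sum V (M : vsubspace V) n (c : 'I_n -> K) (e : 'I_n -> subsp M) :
  val (\sum_i c i *: e i) = \sum_i c i *: val (e i).
Proof. by rewrite raddf_sum; apply: eq_bigr => i _; exact: linearZ. Qed.

Lemma subsp_basisP V (M : vsubspace V) n : has_basis_of_size (subsp M) n <->
  exists f : 'I_n -> V, free_mod vs_zero f /\ vs_set M = vs_set (vs_span f).
Proof.
rewrite basisP; split=> [[e [fe ge]]|[f [ff Mf]]].
  exists (val \o e); split=> [c /= c0|].
    by apply: fe => /=; apply: val_inj; rewrite val_sum.
  apply/seteqP; split=> v /=; last first.
    move=> /vs_spanP[c ->]; apply: vs_set_sum => i.
    by apply/asboolP; exact: (valP (e i)).
  move=> /asboolP Mv; have /vs_spanP[c] := ge (Sub v Mv).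
  by move=> /(congr1 val); rewrite val_sum SubK => ->; exact: vs_span_sum.
have Pf i : vs_pred M (f i) by apply/asboolP; rewrite Mf; exact: vs_span_mem.
exists (fun i => Sub (f i) (Pf i)); split=> [c /(congr1 val)|v].
  by rewrite val_sum; under eq_bigr do rewrite SubK; exact: ff.
have : vs_set (vs_span f) (val v) by rewrite -Mf; apply/asboolP; exact: (valP v).
move=> /vs_spanP[c vc]; apply/vs_spanP; exists c; apply: val_inj.
by rewrite val_sum vc; under [RHS]eq_bigr do rewrite SubK.
Qed.

Lemma toquot_sum V (M : vsubspace V) n (c : 'I_n -> K) (f : 'I_n -> V) :
  toquot M (\sum_i c i *: f i) = \sum_i c i *: toquot M (f i).
Proof.
elim: n => [|n IH] in c f *; first by rewrite !big_ord0 toquot0.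
by rewrite !big_ord_recr /= toquotD toquotZ IH.
Qed.

Lemma quotsp_basisP V (M : vsubspace V) n : has_basis_of_size (quotsp M) n <->
  exists f : 'I_n -> V, free_mod M f /\ forall v, vs_set (vs_addspan M f) v.
Proof.
have toquot_eq0 v : toquot M v = 0 <-> vs_set M v.
  by rewrite -(toquot0 M) toquotP subr0.
rewrite basisP; split=> [[e [fe ge]]|[f [ff gf]]].
  exists (@quotsp_repr _ _ M \o e).
  split=> [c /toquot_eq0|v].
    by rewrite toquot_sum; under eq_bigr do rewrite /= quotsp_reprK; exact: fe.
  have /vs_spanP[c vc] := ge (toquot M v); exists c; apply/toquotP.
  by rewrite toquot_sum vc; apply: eq_bigr => i _; rewrite quotsp_reprK.
exists (toquot M \o f); split=> [c /= c0|q].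
  by apply: ff; apply/toquot_eq0; rewrite toquot_sum.
apply/vs_spanP; rewrite -(quotsp_reprK q); have [c /toquotP ->] := gf (quotsp_repr q).
by exists c; rewrite toquot_sum.
Qed.

Lemma subsp_fin_gen V (M : vsubspace V) n (f : 'I_n -> V) :
  (forall i, vs_set M (f i)) -> (vs_set M `<=` vs_set (vs_span f)) ->
  exists m, has_basis_of_size (subsp M) m.
Proof.
move=> Mf Mspan; have Pf i : vs_pred M (f i) by exact/asboolP.
apply: (@fin_gen_basis _ n (fun i => Sub (f i) (Pf i))) => v.
have : vs_set M (val v) by apply/asboolP; exact: (valP v).
move=> /Mspan /vs_spanP[c vc]; apply/vs_spanP; exists c; apply: val_inj.
by rewrite val_sum vc; under [RHS]eq_bigr do rewrite SubK.
Qed.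

Lemma quotsp_fin_gen V (M : vsubspace V) n (f : 'I_n -> V) :
  (forall v, vs_set (vs_addspan M f) v) -> exists m, has_basis_of_size (quotsp M) m.
Proof.
move=> gf; apply: (@fin_gen_basis _ n (toquot M \o f)) => q.
apply/vs_spanP; rewrite -(quotsp_reprK q); have [c /toquotP ->] := gf (quotsp_repr q).
by exists c; rewrite toquot_sum.
Qed.

End Dimension.

(** * The index from a finite-dimensional preimage *)

Section IndexAlgebra.
Context {K : fieldType} {X : lmodType K}.
Variables (B : linrel X X) (a b : nat) (w : 'I_a -> X) (f : 'I_b -> X).
Hypotheses (free_w : free_mod vs_zero w) (free_f : free_mod (lr_mul B) f).
Hypothesis (w_pre : forall i, exists2 y, vs_set (vs_span f) y & vs_set B (w i, y)).
Hypothesis (pre_w : forall x y, vs_set B (x, y) -> vs_set (vs_span f) y ->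
  vs_set (vs_span w) x).
Hypothesis (gen_f : forall y, vs_set (vs_addspan (lr_ran B) f) y).

(* With respect to the bases [w] of the preimage of [span f] and [f] of [span f], the
   relation acts as a matrix [A]; its kernel and cokernel are those of [B]. *)
Lemma index_basis : exists r, [/\ (r <= a)%N, (r <= b)%N,
  has_basis_of_size (subsp (lr_ker B)) (a - r) &
  has_basis_of_size (quotsp (lr_ran B)) (b - r)].
Proof.
have /choice[rowA rowAP] : forall i, exists c : 'rV[K]_b, vs_set B (w i, rcomb c f).
  by move=> i; have [y /rcomb_span[c ->] Bw] := w_pre i; exists c.
pose A := \matrix_i rowA i.
have BA (d : 'rV_a) : vs_set B (rcomb d w, rcomb (d *m A) f).
  rewrite rcomb_mul; have -> : (fun i => rcomb (row i A) f) = (fun i => rcomb (rowA i) f).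
    by apply/funext => i; rewrite rowK.
  exact: (graph_sum (fun i => d 0 i)).
have Bf0 (c : 'rV_b) : vs_set B (0, rcomb c f) -> c = 0.
  exact: ((rcomb_free _ _).1 free_f).
exists (\rank A); split; [exact: rank_leq_row | exact: rank_leq_col | |].
(* [rcomb d w] is in the kernel of [B] iff [d *m A = 0], because [f] is independent modulo [B(0)].
   So the left kernel of [A] provides the basis. *)
- rewrite -mxrank_ker; apply/subsp_basisP.
  exists (fun k => rcomb (row k (row_base (kermx A))) w); split.
    apply/rcomb_free => c /=; rewrite -rcomb_mul => /((rcomb_free _ _).1 free_w) c0.
    by apply/eqP; rewrite -(mulmx_free_eq0 _ (row_base_free (kermx A))) c0.
  apply/seteqP; split=> x; rewrite rcomb_span.
    move=> Bx0; have /rcomb_span[d xd] := pre_w Bx0 (vs_set0 _).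
    have dA : d *m A = 0.
      by apply: Bf0; have := graphB (BA d) Bx0; rewrite subr0 xd subrr.
    have /submxP[c dc] : (d <= row_base (kermx A))%MS by rewrite eq_row_base; apply/sub_kermxP.
    by exists c; rewrite -rcomb_mul -dc.
  move=> [c ->]; rewrite -rcomb_mul; have := BA (c *m row_base (kermx A)).
  suff -> : c *m row_base (kermx A) *m A = 0 by rewrite rcomb0.
  by apply/sub_kermxP; rewrite (submx_trans (submxMl _ _))// eq_row_base.
(* A vector [rcomb c f] lies in the range of [B] iff [c] is in the row space of [A]. A complement of
   the row space therefore gives a basis modulo the range. *)
- rewrite -mxrank_compl; apply/quotsp_basisP.
  exists (fun k => rcomb (row k (row_base A^C%MS)) f); split.
    apply/rcomb_free => c; rewrite -rcomb_mul => /lr_ranP[x Bx].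
    have /rcomb_span[d xd] := pre_w Bx ((rcomb_span _ _).2 (ex_intro _ _ erefl)).
    have dA : d *m A = c *m row_base A^C%MS.
      apply/eqP; rewrite -subr_eq0; apply/eqP; apply: Bf0.
      by have := graphB (BA d) Bx; rewrite rcombB xd subrr.
    apply/eqP; rewrite -(mulmx_free_eq0 _ (row_base_free A^C%MS)) -submx0 -(capmx_compl A).
    by rewrite sub_capmx -{1}dA submxMl (submx_trans (submxMl _ _))// eq_row_base.
  move=> y; have /rcomb_addspan[h yh] := gen_f y.
  have : (h <= A + row_base A^C%MS)%MS.
    apply: (@submx_trans _ _ _ _ _ _ (A + A^C)%MS).
      by apply: submx_full; rewrite addsmx_compl_full.
    by rewrite addsmxS// eq_row_base.
  move=> /sub_addsmxP[[d c] hE]; apply/rcomb_addspan; exists c.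
  rewrite -rcomb_mul; move: yh => /lr_ranP[x Bx]; apply/lr_ranP.
  exists (x + rcomb d w); have := graphD Bx (BA d).
  by rewrite hE /= rcombD opprD [- _ - _]addrC addrA subrK.
Qed.

End IndexAlgebra.

Lemma kappa_basis (R : realType) (X : normedModType R[i]) (B : linrel X X) m n :
  has_basis_of_size (subsp (lr_ker B)) m -> has_basis_of_size (quotsp (lr_ran B)) n ->
  lr_kappa B = (m%:Z - n%:Z)%:E.
Proof.
by move=> Bm Bn; rewrite /lr_kappa /lr_alpha /lr_beta (vdim_basis Bm) (vdim_basis Bn).
Qed.

(** * Relatively compact perturbations *)

Lemma toquotB (K : fieldType) (V : lmodType K) (M : vsubspace V) x y :
  toquot M (x - y) = toquot M x - toquot M y.
Proof. by apply/eqP; rewrite eq_sym subr_eq -toquotD subrK. Qed.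

Section Quotient.
Context {R : realType}.
Local Open Scope complex_scope.

Lemma nquot_norm_le (X : normedModType R[i]) (M : vsubspace X) (x : X) :
  `|to_nquot M x| <= `|x|.
Proof.
rewrite -rnormE -[X in X <= _]/((nquot_rnorm (to_nquot M x))%:C) lecR.
by apply: ge_inf; [exists 0 => _ [y _ <-]; exact: rnorm_ge0 | exists x].
Qed.

(** The quotient is by the closure of [M]; the strict inequality leaves room to replace an element
    of the closure by one of [M]. *)
Lemma nquot_norm_lt (X : normedModType R[i]) (M : vsubspace X) (x : X) (r : R) :
  `|to_nquot M x| < r%:C -> exists2 m, vs_set M m & rnorm (x - m) < r.
Proof.
rewrite -[X in X < _]/((nquot_rnorm (to_nquot M x))%:C) ltcR => xr.
have hi : has_inf [set rnorm y | y in [set y | to_nquot M y = to_nquot M x]].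
  by split; [exists (rnorm x), x | exists 0 => _ [y _ <-]; exact: rnorm_ge0].
have [_ [y yx <-] yr] := inf_lt hi.1 xr.
have /rnorm_closureP/(_ (r - rnorm y)) := (toquotP (vs_closure M) x y).1 (esym yx).
rewrite subr_gt0 => /(_ yr)[m Mm xym]; exists m => //.
have -> : x - m = (x - y - m) + y by rewrite addrAC subrK.
by apply: le_lt_trans (rnormD _ _) _; lra.
Qed.

Lemma precompact_balls (V : normedModType R[i]) (A : set V) (e : R) : 0 < e ->
  precompact A -> exists l : seq V, forall x, A x -> exists2 k, k \in l & `|k - x| < e%:C.
Proof.
move=> e0; rewrite precompactE compact_cover => cA.
have eC : 0 < e%:C :> R[i] by rewrite ltcR.
have [|x Ax|D _ DA] := cA V setT (fun k => ball k e%:C).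
- by move=> k _; exact: ball_open.
- by exists x => //; exact: ballxx.
- exists (finmap.enum_fset D) => x Ax; have [k /= kD kx] := DA x (subset_closure Ax).
  by exists k => //; move: kx; rewrite -ball_normE.
Qed.

Context {X : normedModType R[i]}.
Variables T S : linrel X X.
Hypothesis S_dom : vs_set (lr_dom T) `<=` vs_set (lr_dom S).

(** The bound between quotient norms becomes one between elements: the error [e] pays for a value of
    [S] at [x] that nearly attains the distance to [S(0)]. *)
Lemma rel_bound_graph : rel_bound_lt1 S T -> exists a b : R, [/\ 0 <= a, 0 <= b, b < 1 &
  forall x t, vs_set T (x, t) -> forall e : R, 0 < e ->
  exists2 s, vs_set S (x, s) & rnorm s <= a * rnorm x + b * rnorm t + e].
Proof.
move=> [a [b [a0 b0 b1 ST]]]; exists a, b; split=> //; [exact: ltW|exact: ltW|].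
move=> x t Txt e e0; have Dx : vs_set (lr_dom T) x by exists t.
have [s Sxs] := S_dom Dx.
have : `|to_nquot (lr_mul S) s| < (a * rnorm x + b * rnorm t + e)%:C.
  rewrite -(qopE Sxs); apply: le_lt_trans (ST x Dx) _.
  rewrite (qopE Txt); apply: (@le_lt_trans _ _ (a%:C * `|x| + b%:C * `|t|)).
    by rewrite lerD2l ler_wpM2l ?nquot_norm_le// ler0c ltW.
  rewrite -!rnormE -!(rmorphM (real_complex R)) -(rmorphD (real_complex R)) ltcR /=.
  by rewrite ltrDl.
move=> /nquot_norm_lt[m Sm sm]; exists (s - m); last exact: ltW.
by have := graphB Sxs Sm; rewrite subr0.
Qed.

(** The net consists of representatives of a finite net in the quotient; adding an element of [S(0)]
    to a value of [S] brings it close to one of them. *)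
Lemma rel_compact_graph : rel_compact S T -> forall e : R, 0 < e ->
  exists l : seq X, forall x t, vs_set T (x, t) -> rnorm x + rnorm t <= 1 ->
  exists s k, [/\ vs_set S (x, s), k \in l & rnorm (s - k) < e].
Proof.
move=> cST e e0; have [l lP] := precompact_balls e0 cST.
exists [seq quotsp_repr k | k <- l] => x t Txt xt1.
have Dx : vs_set (lr_dom T) x by exists t.
have [s Sxs] := S_dom Dx.
have Px : vs_pred (lr_dom T) x by exact/asboolP.
pose u : graphdom T := Sub x Px.
have Wus : lr_val (lr_comp S (graphdom_inj T)) u s by exists x.
have [|k kl] := lP (qop (lr_comp S (graphdom_inj T)) u).
  exists u => //; split; first by exists s.
  rewrite -[X in X <= _]/(`|x| + `|qop T x|).
  apply: (@le_trans _ _ (`|x| + `|t|)).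
    by rewrite lerD2l (qopE Txt) nquot_norm_le.
  by rewrite -!rnormE -(rmorphD (real_complex R)) lecR.
rewrite (qopE Wus) -(quotsp_reprK k) /to_nquot -toquotB => /nquot_norm_lt[m].
move=> [z /= -> Sm] km; exists (s + m), (quotsp_repr k); split.
- by have := graphD Sxs Sm; rewrite addr0.
- exact: map_f.
- by rewrite rnorm_distC opprD addrA.
Qed.

End Quotient.

Lemma vs_set_inj (K : fieldType) (V : lmodType K) (M N : vsubspace V) :
  vs_set M = vs_set N -> M = N.
Proof.
case: M N => [A Ap] [B Bp] /= AB; subst B.
by congr VSubspace; exact: Prop_irrelevance.
Qed.

(** * Algebra of the relations [A + dS] *)

Section Perturbation.
Context {K : fieldType} {X : lmodType K}.
Implicit Types A S T : linrel X X.

Fact lr_pert_subspace A S (d : K) : is_subspace [set p : X * X |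
  exists a s, [/\ vs_set A (p.1, a), vs_set S (p.1, s) & p.2 = a + d *: s]].
Proof.
split.
  exists 0, 0; split; [exact: (vs_set0 A) | exact: (vs_set0 S)|].
  by rewrite scaler0 addr0.
move=> c [x t] [x' t'] [a [s [Aa Ss /= ->]]] [a' [s' [Aa' Ss' /= ->]]].
exists (c *: a + a'), (c *: s + s'); split.
- exact: (@lr_val_lin _ _ _ A).
- exact: (@lr_val_lin _ _ _ S).
- by rewrite !scalerDr !scalerA mulrC addrACA.
Qed.
Definition lr_pert A S d : linrel X X := VSubspace (lr_pert_subspace A S d).

Lemma lr_shiftP (l : K) T x y :
  vs_set (lr_shift l T) (x, y) <-> exists2 t, vs_set T (x, t) & y = l *: x - t.
Proof.
split=> [[_ [_ [/= -> [t Txt ->] ->]]]|[t Txt ->]]; first by exists t.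
by exists (l *: x), (- t); split=> //; exists t.
Qed.

(** The left-hand side may use two different values of [S] at the same point. They differ by an
    element of [S(0)], which is absorbed by [A]. *)
Lemma lr_pert_pert A S c d : vs_set (lr_mul S) `<=` vs_set (lr_mul A) ->
  lr_pert (lr_pert A S c) S d = lr_pert A S (c + d).
Proof.
move=> SA; apply: vs_set_inj; apply/seteqP; split=> -[x y] /=.
  move=> [_ [s [[a [s' [/= Aa Ss' ->]]] Ss ->]]].
  exists (a + c *: (s' - s)), s; split=> //.
    have := graphD Aa (graphZ c (SA _ _ : vs_set A (0, s' - s))).
    by rewrite scaler0 addr0; apply; have := graphB Ss' Ss; rewrite subrr.
  by rewrite scalerBr scalerDl -!addrA addKr.
move=> [a [s [/= Aa Ss ->]]]; exists (a + c *: s), s; split=> //.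
  by exists a, s.
by rewrite scalerDl addrA.
Qed.

Lemma lr_pert0 A S : vs_set (lr_dom A) `<=` vs_set (lr_dom S) -> lr_pert A S 0 = A.
Proof.
move=> AS; apply: vs_set_inj; apply/seteqP; split=> -[x y] /=.
  by move=> [a [s [/= Aa Ss ->]]]; rewrite scale0r addr0.
move=> Axy; have [s Ss] : vs_set (lr_dom S) x by apply: AS; exists y.
by exists y, s; split=> //; rewrite scale0r addr0.
Qed.

Lemma lr_shift_add l T S : lr_shift l (lr_add T S) = lr_pert (lr_shift l T) S (-1).
Proof.
apply: vs_set_inj; apply/seteqP; split=> -[x y].
  move=> /lr_shiftP[_ [t [s [/= Tt Ss ->]]] ->]; exists (l *: x - t), s; split=> //.
    by apply: (lr_shiftP l T x _).2; exists t.
  by rewrite scaleN1r opprD addrA.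
move=> [_ [s [/lr_shiftP[t Tt ->] Ss yE]]]; apply/lr_shiftP.
rewrite /= in yE; rewrite yE.
exists (t + s); first by exists t, s.
by rewrite scaleN1r opprD addrA.
Qed.

Lemma lr_mul_shift l T : vs_set (lr_mul (lr_shift l T)) = vs_set (lr_mul T).
Proof.
apply/seteqP; split=> y; first move=> /lr_shiftP[t Tt ->].
  by have := graphZ (-1) Tt; rewrite !scaler0 scaleN1r add0r.
move=> Ty; apply/lr_shiftP; exists (- y); last by rewrite scaler0 opprK add0r.
by have := graphZ (-1) Ty; rewrite scaler0 scaleN1r.
Qed.

Lemma lr_mul_pert A S d : vs_set (lr_mul S) `<=` vs_set (lr_mul A) ->
  vs_set (lr_mul (lr_pert A S d)) = vs_set (lr_mul A).
Proof.
move=> SA; apply/seteqP; split=> y.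
  move=> [a [s [Aa Ss yE]]]; rewrite /= in yE; rewrite yE.
  by apply: vs_setD => //; exact/vs_setZ/SA.
by move=> Ay; exists y, 0; split=> //; [exact: (vs_set0 S) | rewrite scaler0 addr0].
Qed.

End Perturbation.

Section Admissible.
Context {R : realType} {X : completeNormedModType R[i]}.
Local Open Scope complex_scope.
Implicit Types A S T : linrel X X.

Lemma lr_mul_closed T : closed_linrel T -> closed (vs_set (lr_mul T)).
Proof.
move=> cT; apply: closed_rnorm => y yT; apply: cT; apply/closure_pairP => e /yT[y' Ty' yy'].
by exists 0, y'; split=> //; rewrite subrr (le_lt_trans _ yy')// rnorm0 rnorm_ge0.
Qed.

Definition net_compact A S := forall e : R, 0 < e -> exists l : seq X,
  forall x a, vs_set A (x, a) -> rnorm x <= 1 -> rnorm a <= 1 ->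
  exists s k, [/\ vs_set S (x, s), k \in l & rnorm (s - k) < e].

Definition admissible A S := [/\ closed_linrel A,
  vs_set (lr_mul S) `<=` vs_set (lr_mul A) & net_compact A S].

Section Bounded.
Variables (T S : linrel X X) (a b : R).
Hypotheses (a0 : 0 <= a) (b0 : 0 <= b) (b1 : b < 1).
Hypothesis ST : forall x t, vs_set T (x, t) -> forall e : R, 0 < e ->
  exists2 s, vs_set S (x, s) & rnorm s <= a * rnorm x + b * rnorm t + e.
Hypothesis SmulT : vs_set (lr_mul S) `<=` vs_set (lr_mul T).
Variables (r : R).
Hypotheses (r0 : 0 <= r) (r1 : r <= 1).

(* The bound on [T x] by [(T + rS) x] uses [b < 1]: it is obtained by absorbing
   [b |T x|] into the left-hand side, where [|T x|] is an infimum. *)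
Lemma bounded_decomposition : exists2 C : R, 0 <= C & forall x t s,
  vs_set T (x, t) -> vs_set S (x, s) -> exists t' s',
  [/\ vs_set T (x, t'), vs_set S (x, s'), t' + r%:C *: s' = t + r%:C *: s,
      rnorm t' <= C * (rnorm x + rnorm (t + r%:C *: s)) &
      rnorm s' <= C * (rnorm x + rnorm (t + r%:C *: s))].
Proof.
have [ha hb hb1 hr hr1] := And5 a0 b0 b1 r0 r1.
have b1' : 0 < 1 - b by lra.
(* With [p] and the infimum [m] introduced below, the value [s'] has norm at most [a p + b m + 2 p],
   whence [m <= (3 + a) p + b m], that is [m <= M p]. Then [s'] is bounded by [(a + M + 2) p] and
   [t'] by [(a + M + 3) p]. *)
pose M := (3 + a) / (1 - b).
have M0 : 0 <= M by rewrite divr_ge0//; lra.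
exists (a + M + 3); first by lra.
move=> x t s Tt Ss; set y := t + r%:C *: s; set p := rnorm x + rnorm y.
have x0 := rnorm_ge0 x; have y0 := rnorm_ge0 y.
have [p0|p0] : p = 0 \/ 0 < p.
- have : 0 <= p by rewrite /p addr_ge0.
  by rewrite le_eqVlt => /orP[/eqP <-|]; [left|right].
-
  have xx : x = 0 by apply: rnorm_eq0; rewrite /p in p0; lra.
  have yy : y = 0 by apply: rnorm_eq0; rewrite /p in p0; lra.
  exists 0, 0; rewrite xx yy; split; [exact: (vs_set0 T)|exact: (vs_set0 S)| | |].
  + by rewrite scaler0 addr0.
  + by rewrite rnorm0 p0 mulr0.
  + by rewrite rnorm0 p0 mulr0.
pose Q := [set rnorm u | u in [set u | vs_set T (x, u)]].
have Qi : has_inf Q by split; [exists (rnorm t), t | exists 0 => _ [u _ <-]; exact: rnorm_ge0].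
pose m := inf Q.
have mle u : vs_set T (x, u) -> m <= rnorm u by move=> Tu; apply: ge_inf; [exact: Qi.2|exists u].
have m0 : 0 <= m by apply: lb_le_inf; [exact: Qi.1 | move=> _ [u _ <-]; exact: rnorm_ge0].
have [_ [t1 Tt1 <-] t1m] := inf_adherent p0 Qi.
have [s' Ss' s'le] := ST Tt1 p0.
(* Replacing [s] by [s'] while keeping the sum [y] changes [t] by a multiple of [s - s'], an element
   of [S(0)] and so of [T(0)]. *)
exists (y - r%:C *: s'), s'.
have Tt' : vs_set T (x, y - r%:C *: s').
  rewrite /y -addrA -scalerBr.
  have /SmulT : vs_set S (0, s - s') by have := graphB Ss Ss'; rewrite subrr.
  by move=> /(graphZ r%:C)/(graphD Tt); rewrite scaler0 addr0.
have tle : rnorm (y - r%:C *: s') <= rnorm y + rnorm s'.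
  by apply: le_trans (rnormB _ _) _; rewrite lerD2l rnorm_scale// ler_piMl ?rnorm_ge0.
have bt1 : b * rnorm t1 <= b * m + p.
  have : b * rnorm t1 <= b * (m + p) by rewrite ler_wpM2l// ltW.
  by move/le_trans; apply; rewrite mulrDr lerD2l ler_piMl// ltW.
have ax : a * rnorm x <= a * p by rewrite ler_wpM2l// /p lerDl.
have yp : rnorm y <= p by rewrite /p lerDr.
have mM : m <= M * p.
  rewrite /M mulrAC ler_pdivlMr//.
  by have := mle _ Tt'; lra.
have bm : b * m <= M * p by apply: le_trans mM; rewrite ler_piMl// ltW.
have -> : (a + M + 3) * p = a * p + M * p + 3 * p by ring.
by split=> //; [rewrite subrK | clear -tle s'le bt1 ax yp bm ha; lra |
  clear -s'le bt1 ax bm y0 yp p0; lra].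
Qed.

Variable l : R[i].
Let A := lr_pert (lr_shift l T) S (- r%:C).

Let AP x y : vs_set A (x, y) <-> exists t s,
  [/\ vs_set T (x, t), vs_set S (x, s) & y = l *: x - (t + r%:C *: s)].
Proof.
split=> [[_ [s [/lr_shiftP[t Tt ->] /= Ss ->]]]|[t [s [Tt Ss ->]]]].
  by exists t, s; rewrite opprD addrA scaleNr.
exists (l *: x - t), s; split=> //; first by apply: (lr_shiftP l T x _).2; exists t.
by rewrite scaleNr opprD addrA.
Qed.

Let decompA : exists2 C : R, 0 <= C & forall x y, vs_set A (x, y) -> exists t s,
  [/\ vs_set T (x, t), vs_set S (x, s), y = l *: x - (t + r%:C *: s),
      rnorm t <= C * (rnorm x + rnorm y) & rnorm s <= C * (rnorm x + rnorm y)].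
Proof.
have [C C0 CP] := bounded_decomposition.
pose L := complex.Re `|l|; have L0 : 0 <= L by exact: (rnorm_ge0 (l : R[i]^o)).
exists (C * (1 + L)); first by rewrite mulr_ge0//; lra.
move=> x y /AP[t [s [Tt Ss yE]]]; have [t' [s' [Tt' Ss' E t's s's]]] := CP x t s Tt Ss.
have le : rnorm x + rnorm (t + r%:C *: s) <= (1 + L) * (rnorm x + rnorm y).
  have -> : t + r%:C *: s = l *: x - y by rewrite yE opprB addrCA subrr addr0.
  have := rnormB (l *: x) y; rewrite rnormZ -/L.
  have : 0 <= L * rnorm y by rewrite mulr_ge0// rnorm_ge0.
  have -> : (1 + L) * (rnorm x + rnorm y) = rnorm x + rnorm y + L * rnorm x + L * rnorm y by ring.
  by lra.
exists t', s'; split=> //; first by rewrite E.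
- by apply: le_trans t's _; rewrite -mulrA ler_wpM2l.
- by apply: le_trans s's _; rewrite -mulrA ler_wpM2l.
Qed.

(** [A] is the range of the relation [H] taking the pair of values [(t, s)] to [(x, y)], and
    [decompA] solves [H] with a bound. A point of the closure of [A] thus comes with limits [t] and
    [s] of such values, and it remains to correct them to actual values at [x]. *)
Lemma pert_closed : closed_linrel T -> closed_linrel A.
Proof.
have [ha hb hb1 hr hr1] := And5 a0 b0 b1 r0 r1.
move=> cT; have [C C0 CP] := decompA.
pose Hset := [set p : (X * X) * (X * X) | [/\ vs_set T (p.2.1, p.1.1),
  vs_set S (p.2.1, p.1.2) & p.2.2 = l *: p.2.1 - (p.1.1 + r%:C *: p.1.2)]].
have Hs : is_subspace Hset.
  split.
    split; [exact: (vs_set0 T) | exact: (vs_set0 S)|].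
    by rewrite /= !scaler0 addr0 subr0.
  move=> c [[t s] [x y]] [[t' s'] [x' y']] [/= Tt Ss ->] [/= Tt' Ss' ->].
  split; [exact: (@lr_val_lin _ _ _ T) | exact: (@lr_val_lin _ _ _ S)|] => /=.
  have comm (d : R[i]) (u u' : X) : d *: (c *: u + u') = c *: (d *: u) + d *: u'.
    by rewrite scalerDr !scalerA mulrC.
  by rewrite !comm [in RHS]addrACA -scalerDr [in RHS]opprD [RHS]addrACA -scalerBr.
pose H : linrel (X * X)%type (X * X)%type := VSubspace Hs.
have ranH : vs_set (lr_ran H) = vs_set A.
  apply/seteqP; split=> -[x y].
    by move=> /lr_ranP[[t s] [/= Tt Ss yE]]; apply/AP; exists t, s.
  by move=> /AP[t [s [Tt Ss yE]]]; apply/lr_ranP; exists (t, s).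
have cXX : geo_complete (X * X)%type.
  by apply: geo_complete_prod; exact: geo_complete_completeNormedMod.
rewrite /closed_linrel -ranH => -[x y].
case/(@closure_bounded_solve _ _ _ H (C * 2) cXX _ _ (x, y)).
- by rewrite mulr_ge0.
- move=> z [x' y'] Hz; have : vs_set A (x', y') by rewrite -ranH; apply/lr_ranP; exists z.
  move=> /CP[t [s [Tt Ss yE tC sC]]]; exists (t, s) => //.
  have h : C * (rnorm x' + rnorm y') <= C * 2 * rnorm (x', y').
    rewrite -mulrA ler_wpM2l// rnorm_pair mulr2n mulrDl !mul1r.
    by rewrite lerD// le_max lexx ?orbT.
  by rewrite {1}rnorm_pair ge_max (le_trans tC h) (le_trans sC h).
move=> [t s] _ /closure_pairP cl; rewrite ranH; apply/AP.
have app e : 0 < e -> exists x' y' t' s', [/\ vs_set T (x', t'), vs_set S (x', s'),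
    y' = l *: x' - (t' + r%:C *: s') &
    [/\ rnorm (x - x') < e, rnorm (y - y') < e, rnorm (t - t') < e & rnorm (s - s') < e]].
  move=> /cl[[t' s'] [[x' y'] [[/= Tt Ss yE]]]].
  rewrite !rnorm_pairB !gt_max /= => /andP[? ?] /andP[? ?].
  by exists x', y', t', s'; split.
have Tt : vs_set T (x, t).
  by apply: cT; apply/closure_pairP => e /app[x' [y' [t' [s' [Tt _ _ []]]]]]; exists x', t'.
have [s0 Ss0 _] := ST Tt ltr01.
(* The limit [s] need not be a value of [S] at [x], but it differs from the value [s0] by an element
   of [T(0)]. Indeed adding to [s'] a small value [sg] of [S] at [x - x'] gives a value at [x], so
   [s' + sg - s0] is in [S(0)], and [T(0)] is closed. *)
have Tss0 : vs_set T (0, s - s0).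
  apply: (rnorm_closed (lr_mul_closed cT)) => e e0.
  have k0 : 0 < 1 + a + b + 1 by lra.
  have [x' [y' [t' [s' [Tt' Ss' _ [xe _ te se]]]]]] := app _ (divr_gt0 e0 k0).
  have d0 := divr_gt0 e0 k0.
  have [sg Sg sge] := ST (graphB Tt Tt') d0.
  exists (s' + sg - s0).
    apply: SmulT; have := graphB (graphD Ss' Sg) Ss0.
    by rewrite [x' + _]addrC subrK subrr.
  have -> : s - s0 - (s' + sg - s0) = (s - s') - sg.
    by rewrite opprB addrA subrK opprD addrA.
  apply: le_lt_trans (rnormB _ _) _.
  have h1 : a * rnorm (x - x') <= a * (e / (1 + a + b + 1)) by rewrite ler_wpM2l// ltW.
  have h2 : b * rnorm (t - t') <= b * (e / (1 + a + b + 1)) by rewrite ler_wpM2l// ltW.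
  have : (1 + a + b + 1) * (e / (1 + a + b + 1)) = e by rewrite mulrC divfK// gt_eqF.
  by lra.
(* The difference [s - s0] is moved into the value of [T]. *)
exists (t + r%:C *: (s - s0)), s0; split=> //.
  by have := graphD Tt (graphZ r%:C Tss0); rewrite scaler0 addr0.
rewrite -addrA -scalerDr subrK.
apply/eqP; rewrite -subr_eq0; apply/eqP; apply: rnorm_small_eq0 => e e0.
pose L := complex.Re `|l|; have L0 : 0 <= L by exact: (rnorm_ge0 (l : R[i]^o)).
have k0 : 0 < 3 + L by lra.
have [x' [y' [t' [s' [_ _ yE [xe ye te se]]]]]] := app _ (divr_gt0 e0 k0).
have -> : y - (l *: x - (t + r%:C *: s)) =
   (y - y') - l *: (x - x') + ((t - t') + r%:C *: (s - s')).
  rewrite yE !scalerBr [t - t' + _]addrACA -opprD.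
  move: (t + _) (t' + _) (l *: x) (l *: x') => u u' p p'.
  by rewrite !opprB -!addrA addKr [- p + _]addrA [u' + _]addrC subrK [- p + u]addrC.
apply: le_lt_trans (rnormD _ _) _.
have := rnormB (y - y') (l *: (x - x')); rewrite rnormZ -/L => h1.
have := rnormD (t - t') (r%:C *: (s - s')); rewrite rnorm_scale// => h2.
have h3 : L * rnorm (x - x') <= L * (e / (3 + L)) by rewrite ler_wpM2l// ltW.
have h4 : r * rnorm (s - s') <= rnorm (s - s') by rewrite ler_piMl ?rnorm_ge0.
have : (3 + L) * (e / (3 + L)) = e by rewrite mulrC divfK// gt_eqF.
by lra.
Qed.

Lemma pert_admissible : closed_linrel T ->
  (forall e : R, 0 < e -> exists l : seq X, forall x t, vs_set T (x, t) ->
    rnorm x + rnorm t <= 1 ->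
    exists s k, [/\ vs_set S (x, s), k \in l & rnorm (s - k) < e]) ->
  admissible A S.
Proof.
move=> cT netT; split.
- exact: pert_closed.
- by rewrite lr_mul_pert lr_mul_shift.
move=> e e0; have [C C0 CP] := decompA.
(* On the unit ball of the graph of [A] the value [t] has norm at most [2 * C], so dividing by [q]
   lands in the set covered by [netT]. *)
pose q := 1 + C * 2; have q0 : 0 < q by rewrite /q; lra.
have qi0 : 0 <= q^-1 by rewrite invr_ge0 ltW.
have [k kP] := netT _ (divr_gt0 e0 q0).
exists [seq q%:C *: v | v <- k] => x y /CP[t [s [Tt _ _ tC _]]] x1 y1.
have qq : q%:C * q^-1%:C = 1 :> R[i].
  by rewrite -(rmorphM (real_complex R)) mulfV ?gt_eqF.
have [|s' [v [Ss' vk sv]]] := kP _ _ (graphZ q^-1%:C Tt).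
  rewrite !rnorm_scale// -mulrDr mulrC ler_pdivrMr// mul1r.
  have : C * (rnorm x + rnorm y) <= C * 2 by rewrite ler_wpM2l//; lra.
  by rewrite /q; lra.
exists (q%:C *: s'), (q%:C *: v); split.
- by have := graphZ q%:C Ss'; rewrite scalerA qq scale1r.
- exact: map_f.
- by rewrite -scalerBr rnorm_scale ?ltW// mulrC -ltr_pdivlMr.
Qed.

End Bounded.
End Admissible.

(** * Perturbation of semi-Fredholm relations *)

Section PhiPlus.
Context {R : realType} {X : completeNormedModType R[i]}.
Local Open Scope complex_scope.
Implicit Types A B S : linrel X X.

Let cX : geo_complete X := @geo_complete_completeNormedMod R X.

Definition sublevel A (d : R) := [set x : X | rnorm x <= 1 /\
  exists2 a, vs_set A (x, a) & rnorm a <= d].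

(** A quantitative properness: it makes a sequence in the unit ball along which [A] has values
    tending to 0 totally bounded. *)
Definition net_proper A := forall e : R, 0 < e ->
  exists2 d : R, 0 < d & has_net (sublevel A d) e.

(** Split the sublevel set of [B] into finitely many classes according to the net point near a value
    of [S]. Inside a class the values of [S] nearly cancel in differences, so half the difference of
    two members lies in a sublevel set of [B + cS], where nets are available. *)
Lemma net_proper_pert B S (c : R[i]) : net_compact B S ->
  net_proper (lr_pert B S c) -> net_proper B.
Proof.
move=> BS pA e e0; have [d d0 [m mP]] := pA (e / 2) (divr_gt0 e0 (ltr0Sn _ 1)).
pose D := complex.Re `|c|; have D0 : 0 <= D by exact: (rnorm_ge0 (c : R[i]^o)).
(* Half a difference has a value of norm at most [t + D * q], and each of the two terms is at most
   [d / 2]. The bound [t <= 1] chosen below is what [BS] requires. *)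
pose q := d / (2 * (1 + D)); have q0 : 0 < q by rewrite divr_gt0//; lra.
have qD : D * q <= d / 2.
  rewrite /q mulrA ler_pdivrMr; last lra.
  have : 0 <= d * D by rewrite mulr_ge0// ltW.
  by lra.
have [l lP] := BS q q0.
pose t := Num.min 1 (d / 2); have [t1 td] : t <= 1 /\ t <= d / 2.
  by rewrite /t !ge_min !lexx ?orbT.
exists t; first by rewrite lt_min ltr01 divr_gt0.
pose cls k := [set x | rnorm x <= 1 /\ exists b s,
  [/\ vs_set B (x, b), rnorm b <= t, vs_set S (x, s) & rnorm (s - k) < q]].
pose rep k := xget 0 (cls k).
exists [seq rep k + (2 : R)%:C *: y | k <- l, y <- m].
move=> x [x1 [b Bxb bt]].
have [s [k [Ss kl sk]]] := lP x b Bxb x1 (le_trans bt t1).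
have [r1 [b' [s' [Bb' bt' Ss' sk']]]] : cls k (rep k).
  by apply: (@xgetI _ 0 (cls k) x); split=> //; exists b, s.
have [|y ym yx] := mP (2^-1%:C *: (x - rep k)).
  split.
    by rewrite rnorm_scale//; have := rnormB x (rep k); clear -x1 r1; lra.
  exists (2^-1%:C *: ((b - b') + c *: (s - s'))).
    apply: graphZ; exists (b - b'), (s - s'); split=> //; exact: graphB.
  have ss : rnorm (s - s') <= 2 * q.
    by have := rnorm_triangle k s s'; rewrite (rnorm_distC k); clear -sk sk'; lra.
  rewrite rnorm_scale//; have := rnormD (b - b') (c *: (s - s')); rewrite rnormZ -/D.
  have := rnormB b b'; have : D * rnorm (s - s') <= D * (2 * q) by rewrite ler_wpM2l.
  by clear -td qD bt bt'; lra.
exists (rep k + (2 : R)%:C *: y); first by apply/allpairsP; exists (k, y).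
have -> : x - (rep k + (2 : R)%:C *: y) = (2 : R)%:C *: (2^-1%:C *: (x - rep k) - y).
  rewrite scalerBr scalerA -(rmorphM (real_complex R)) mulfV// scale1r.
  by rewrite opprD addrA.
by rewrite rnorm_scale//; clear -yx; lra.
Qed.

(** By the open mapping theorem a vector with a small value is close to the kernel, whose balls have
    finite nets. *)
Lemma PhiPlus_net_proper A : PhiPlus A -> net_proper A.
Proof.
move=> [cA cR /vdim_lty[n /subsp_basisP[f [ff Nf]]]] e e0.
have [C C0 CP] := open_mapping cX cX cA cR.
exists (e / (2 * C)); first by rewrite divr_gt0// mulr_gt0.
have [l lP] := ball_net (1 + e / 2) ff (divr_gt0 e0 (ltr0Sn _ 1)).
exists l => x [x1 [a Axa ae]].
have [x' Ax'a x'a] := CP a ((lr_ranP _ _).2 (ex_intro _ x Axa)).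
have x'e : rnorm x' <= e / 2.
  apply: le_trans x'a _; move: ae; rewrite ler_pdivlMr ?mulr_gt0//; lra.
have [|k kl xk] := lP (x - x').
  split; last by have := rnormB x x'; lra.
  by rewrite -Nf; have := graphB Axa Ax'a; rewrite subrr.
exists k => //; have -> : x - k = (x - x' - k) + x' by rewrite addrAC subrK.
by apply: le_lt_trans (rnormD _ _) _; lra.
Qed.

(** The argument of Riesz: every vector of the unit ball of the kernel is within 1/4 + 1/4 of one of
    finitely many kernel vectors [f i]. Iterating with the identity on their span shows that the
    closed span contains the kernel. *)
Lemma net_proper_ker A : net_proper A -> exists n, has_basis_of_size (subsp (lr_ker A)) n.
Proof.
move=> pA; have [d d0 [l lP]] := pA 4^-1 ltac:(lra).
pose cls k := [set x | [/\ vs_set (lr_ker A) x, rnorm x <= 1 & rnorm (x - k) < 4^-1]].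
pose f (i : 'I_(size l)) := xget 0 (cls (nth 0 l i)).
(* For an empty class [f i] is the default 0, which also qualifies. *)
have fP i : vs_set (lr_ker A) (f i) /\ rnorm (f i) <= 1.
  rewrite /f; case: xgetP => [y _ []//|_]; split; first exact: (vs_set0 (lr_ker A)).
  by rewrite rnorm0.
apply: (subsp_fin_gen (fun i => (fP i).1)).
have Hs : is_subspace [set p : X * X | vs_set (vs_span f) p.1 /\ p.2 = p.1].
  split; first by split=> //; exact: (vs_set0 (vs_span f)).
  move=> c [u u'] [v v'] [/= fu ->] [/= fv ->]; split=> //=.
  exact: (@vs_lin _ _ (vs_span f)).
move=> x Nx; have [||z _ /closure_pairP zx] :=
  @iterated_approximation _ _ _ (VSubspace Hs) (lr_ker A) 1 cX _ x.
- move=> {Nx}x Nx x1; have [|k kl xk] := lP x.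
    by split=> //; exists 0 => //; rewrite rnorm0 ltW.
  have /(nthP 0)[i il ik] := kl; pose j := Ordinal il.
  have [_ _ fk] : cls k (f j) by rewrite /f /= ik; apply: (@xgetI _ 0 (cls k) x).
  exists (f j), (f j); split.
  - by split=> //; exact: vs_span_mem.
  - by have [] := fP j.
  - by apply: vs_setB => //; have [] := fP j.
  - by have := rnorm_triangle k x (f j); rewrite (rnorm_distC k); lra.
- exact: Nx.
- apply: (rnorm_closed (@closed_span _ _ _ f)) => e /zx[z' [x' [[/= fz ->] _ xz]]].
  by exists z'.
Qed.

Lemma ultra_union (U : set_system nat) (I : eqType) (l : seq I) (P : I -> set nat) :
  UltraFilter U -> U (fun n => exists2 k, k \in l & P k n) -> exists k, U (P k).
Proof.
move=> UU; elim: l => [|k l IH] Ul.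
  by have [n [k]] := filter_ex Ul.
have [Pk|nPk] := in_ultra_setVsetC (P k) UU; first by exists k.
apply: IH; apply: filterS2 Ul nPk => n [j]; rewrite inE => /orP[/eqP -> //|jl Pj _].
by exists j.
Qed.

(** Otherwise there are unit ball vectors [x n] with values tending to 0 that stay 1/2 away from the
    kernel. Along an ultrafilter finer than [\oo] the finite nets make them Cauchy, which replaces
    the extraction of a diagonal subsequence; the limit is in the kernel because [A] is closed. *)
Lemma net_proper_near_ker A : closed_linrel A -> net_proper A ->
  exists2 d : R, 0 < d & forall x, sublevel A d x ->
  exists2 n, vs_set (lr_ker A) n & rnorm (x - n) < 2^-1.
Proof.
move=> cA pA; apply: contrapT => nd.
have /choice[x xP] : forall n, exists x, sublevel A (2^-1 ^+ n) x /\
    forall m, vs_set (lr_ker A) m -> 2^-1 <= rnorm (x - m).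
  move=> n; apply: contrapT => nx; apply: nd; exists (2^-1 ^+ n); first by rewrite exprn_gt0.
  move=> x xn; apply: contrapT => nm; apply: nx; exists x; split=> // m Nm.
  by rewrite leNgt; apply/negP => ?; apply: nm; exists m.
have [U [UU ooU]] := @ultraFilterLemma nat \oo _.
have small (e : R) : 0 < e -> U (fun n => 2^-1 ^+ n <= e).
  move=> e0; have [N Ne] := half_pow_lt e0; apply: ooU; exists N => // n /= Nn.
  by apply: le_trans (ltW Ne); rewrite ler_wiXn2l//; lra.
have xc : cvg (x n @[n --> U]).
  apply/cauchy_cvgP/cauchy_exP => e e0.
  have er : e = (complex.Re e)%:C by rewrite RRe_real// gtr0_real.
  have [|d d0 [l lP]] := pA (complex.Re e); first by rewrite -ltcR -er.
  have [|k Uk] := @ultra_union U _ l (fun k => fun n => rnorm (x n - k) < complex.Re e) UU.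
    apply: filterS (small d d0) => n nd'; apply: lP; have [[x1 [a Axa an]] _] := xP n.
    by split=> //; exists a => //; exact: le_trans an nd'.
  exists k; suff : U (x @^-1` ball k e) by [].
  apply: filterS Uk => n xk; rewrite /preimage /=.
  by rewrite -ball_normE /= -rnormE er ltcR rnorm_distC.
have lim_near (e : R) : 0 < e -> U (fun n => rnorm (lim (x n @[n --> U]) - x n) < e).
  move=> e0; have eC : 0 < e%:C :> R[i] by rewrite ltcR.
  by apply: filterS (((cvgrPdist_lt _ _).1 xc) _ eC) => n; rewrite -rnormE ltcR.
have Nl : vs_set (lr_ker A) (lim (x n @[n --> U])).
  apply: cA; apply/closure_pairP => e e0.
  have [e2 e2'] : 0 < e / 2 /\ e / 2 < e by split; lra.
  have [n [xn ne]] := filter_ex (filterI (lim_near e e0) (small _ e2)).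
  have [[_ [a Axa an]] _] := xP n.
  exists (x n), a; split=> //; rewrite sub0r rnormN.
  by apply: le_lt_trans an _; exact: le_lt_trans ne e2'.
have h2 : 0 < 2^-1 :> R by lra.
have [n xn] := filter_ex (lim_near _ h2).
by have [_ /(_ _ Nl)] := xP n; rewrite leNgt rnorm_distC xn.
Qed.

(** Take a solution [x'] of norm minimal up to the norm of [a]. If it were too long, its
    normalization would be within 1/2 of the kernel, and subtracting a kernel vector would leave a
    solution less than half as long, against near minimality. *)
Lemma net_proper_solve A : closed_linrel A -> net_proper A ->
  exists2 C : R, 0 <= C & forall x a, vs_set A (x, a) ->
  exists2 x', vs_set A (x', a) & rnorm x' <= C * rnorm a.
Proof.
move=> cA pA; have [d d0 dP] := net_proper_near_ker cA pA.
exists (2 + d^-1); first by rewrite addr_ge0 ?invr_ge0 ?ltW.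
move=> x a Axa; have [->|a0] := eqVneq a 0.
  by exists 0; [exact: (vs_set0 A) | rewrite !rnorm0 mulr0].
have p0 := rnorm_gt0 a0.
pose Q := [set rnorm u | u in [set u | vs_set A (u, a)]].
have Qi : has_inf Q by split; [exists (rnorm x), x | exists 0 => _ [u _ <-]; exact: rnorm_ge0].
have [_ [x' Ax'a <-] x'm] := inf_adherent p0 Qi.
exists x' => //; rewrite leNgt; apply/negP => x'a.
have di : 0 < d^-1 by rewrite invr_gt0.
have dp : 0 <= d^-1 * rnorm a by rewrite mulr_ge0 ?ltW.
have x'0 : 0 < rnorm x' by apply: le_lt_trans x'a; rewrite mulrDl; lra.
have xi : 0 <= (rnorm x')^-1 by rewrite invr_ge0 ltW.
have [|n Nn xn] := dP ((rnorm x')^-1%:C *: x').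
  split; first by rewrite rnorm_scale// mulVf// gt_eqF.
  exists ((rnorm x')^-1%:C *: a); first exact: graphZ.
  rewrite rnorm_scale// ler_pdivrMl//; move: x'a; rewrite mulrDl => x'a.
  by rewrite -ler_pdivrMr// mulrC; lra.
have : inf Q <= rnorm (x' - (rnorm x')%:C *: n).
  apply: ge_inf; first exact: Qi.2.
  exists (x' - (rnorm x')%:C *: n) => //=.
  by have := graphB Ax'a (graphZ (rnorm x')%:C Nn); rewrite scaler0 subr0.
have -> : x' - (rnorm x')%:C *: n = (rnorm x')%:C *: ((rnorm x')^-1%:C *: x' - n).
  by rewrite scalerBr scalerA -(rmorphM (real_complex R)) mulfV ?gt_eqF// scale1r.
rewrite rnorm_scale ?rnorm_ge0//.
have : rnorm x' * rnorm ((rnorm x')^-1%:C *: x' - n) < rnorm x' * 2^-1 by rewrite ltr_pM2l.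
by move: x'a; rewrite mulrDl; lra.
Qed.

Lemma net_proper_PhiPlus A : closed_linrel A -> net_proper A -> PhiPlus A.
Proof.
move=> cA pA; split=> //.
  have [C C0 CP] := net_proper_solve cA pA.
  exact: (closed_ran_bounded_solve cX C0 cA CP).
by have [n /vdim_basis] := net_proper_ker pA; rewrite /lr_alpha => ->; rewrite ltry.
Qed.

Lemma PhiPlus_pert B S (c : R[i]) : closed_linrel B -> net_compact B S ->
  PhiPlus (lr_pert B S c) -> PhiPlus B.
Proof.
by move=> cB BS /PhiPlus_net_proper/(net_proper_pert BS); exact: net_proper_PhiPlus.
Qed.

End PhiPlus.

(** * Stability of [Phi_-] *)

Section PhiMinus.
Context {R : realType} {X : completeNormedModType R[i]}.
Local Open Scope complex_scope.
Implicit Types A B S : linrel X X.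

Let cX : geo_complete X := @geo_complete_completeNormedMod R X.

Let cXX : geo_complete (X * X)%type.
Proof. exact: geo_complete_prod. Qed.

(** The relation taking [(x, u)] to [A x + u] for [u] in [span f]. It presents [R(A) + span f] as a
    range, to which the open mapping theorem and iteration apply. *)
Fact lr_plus_span_subspace A n (f : 'I_n -> X) : is_subspace
  [set p : (X * X) * X | vs_set (vs_span f) p.1.2 /\ vs_set A (p.1.1, p.2 - p.1.2)].
Proof.
split; first by split; [exact: (vs_set0 (vs_span f)) | rewrite /= subr0; exact: (vs_set0 A)].
move=> c [[x u] y] [[x' u'] y'] [fu Au] [fu' Au']; split.
  exact: (@vs_lin _ _ (vs_span f)).
have := lr_val_lin (T := A) c Au Au'; rewrite /lr_val /= scalerBr.
by rewrite addrACA -opprD.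
Qed.
Definition lr_plus_span A n (f : 'I_n -> X) : linrel (X * X)%type X :=
  VSubspace (lr_plus_span_subspace A f).

Lemma lr_plus_span_closed A n (f : 'I_n -> X) : closed_linrel A ->
  closed (vs_set (lr_plus_span A f)).
Proof.
move=> cA [[x u] y] /closure_pairP cl.
have app (e : R) : 0 < e -> exists x' u' y', [/\ vs_set (vs_span f) u',
    vs_set A (x', y' - u') & [/\ rnorm (x - x') < e, rnorm (u - u') < e & rnorm (y - y') < e]].
  move=> /cl[[x' u'] [y' [[/= fu Au]]]]; rewrite rnorm_pairB gt_max /= => /andP[? ?] ?.
  by exists x', u', y'.
split => /=.
  apply: (rnorm_closed (@closed_span _ _ _ f)) => e /app[x' [u' [y' [fu _ [_ uu _]]]]].
  by exists u'.
apply: cA; apply/closure_pairP => e e0.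
have e2 : 0 < e / 2 by lra.
have [x' [u' [y' [_ Au [xx uu yy]]]]] := app _ e2.
exists x', (y' - u'); split=> //; first by lra.
have -> : y - u - (y' - u') = (y - y') - (u - u').
  by rewrite !opprD !opprK addrACA.
by apply: le_lt_trans (rnormB _ _) _; lra.
Qed.

Lemma complement_solve A n (f : 'I_n -> X) : closed_linrel A ->
  (forall y, vs_set (vs_addspan (lr_ran A) f) y) ->
  exists2 C : R, 0 < C & forall y, exists x a u,
    [/\ vs_set A (x, a), vs_set (vs_span f) u, y = a + u &
    [/\ rnorm x <= C * rnorm y, rnorm a <= C * rnorm y & rnorm u <= C * rnorm y]].
Proof.
move=> cA gf; pose H := lr_plus_span A f.
have ranH : vs_set (lr_ran H) = setT.
  apply/seteqP; split=> // y _; have [c /lr_ranP[x Ax]] := gf y; apply/lr_ranP.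
  by exists (x, \sum_i c i *: f i); split=> //=; exact: vs_span_sum.
have [||C C0 CP] := @open_mapping _ _ _ H cXX cX.
- exact: lr_plus_span_closed.
- by rewrite ranH; exact: closedT.
exists (1 + C); first lra.
move=> y; have [|[x u] [/= fu Au]] := CP y; first by rewrite ranH.
rewrite rnorm_pair ge_max => /andP[xy uy].
have y0 := rnorm_ge0 y.
exists x, (y - u), u; split=> //; first by rewrite subrK.
by split; have := rnormB y u; rewrite mulrDl mul1r; lra.
Qed.

(** Split [y] as [a + u] with [u] in the complement [span f]. Then [u] depends only on the class of
    [y] modulo the range and is bounded by the distance of [y] to the range up to a constant, so it
    vanishes on the closure. *)
Lemma finite_codim_closed A n : closed_linrel A ->
  has_basis_of_size (quotsp (lr_ran A)) n -> closed (vs_set (lr_ran A)).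
Proof.
move=> cA /quotsp_basisP[f [ff gf]]; have [C C0 CP] := complement_solve cA gf.
apply: closed_rnorm => y yR.
have [x [a [u [Axa fu yE _]]]] := CP y.
suff u0 : u = 0 by rewrite yE u0 addr0; apply/lr_ranP; exists x.
apply: rnorm_small_eq0 => e e0.
have [y' Ry' yy'] := yR _ (divr_gt0 e0 C0).
have [x1 [a1 [u1 [Axa1 fu1 yE1 [_ _ u1C]]]]] := CP (y - y').
suff -> : u = u1.
  by apply: le_lt_trans u1C _; rewrite mulrC -ltr_pdivlMr.
have : vs_set (lr_ran A) (u - u1).
  have -> : u - u1 = a1 + y' - a.
    have -> : u = y - a by rewrite yE addrC addKr.
    have -> : u1 = y - y' - a1 by rewrite yE1 addrC addKr.
    by rewrite !opprD !opprK [LHS](AC (2*3) ((1*3)*((5*4)*2))) /= subrr add0r.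
  by apply: vs_setB; [apply: vs_setD => //|]; apply/lr_ranP; [exists x1|exists x].
have /rcomb_span[c ->] := fu; have /rcomb_span[c1 ->] := fu1.
by rewrite -rcombB => /((rcomb_free _ _).1 ff)/eqP; rewrite subr_eq0 => /eqP ->.
Qed.

Lemma seq_bound (V : normedModType R[i]) (l : seq V) :
  exists2 K : R, 0 <= K & forall k, k \in l -> rnorm k <= K.
Proof.
elim: l => [|k l [K K0 lK]]; first by exists 0.
exists (K + rnorm k); first by rewrite addr_ge0 ?rnorm_ge0.
move=> j; rewrite inE => /orP[/eqP ->|/lK jK]; first by rewrite lerDr.
by apply: le_trans jK _; rewrite lerDl rnorm_ge0.
Qed.

Definition cat_fam (V : lmodType R[i]) m n (f : 'I_m -> V) (g : 'I_n -> V) (i : 'I_(m + n)) :=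
  match fintype.split i with inl j => f j | inr j => g j end.

Lemma cat_famP (V : lmodType R[i]) m n (f : 'I_m -> V) (g : 'I_n -> V) u v :
  vs_set (vs_span f) u -> vs_set (vs_span g) v -> vs_set (vs_span (cat_fam f g)) (u + v).
Proof.
move=> /vs_spanP[c ->] /vs_spanP[d ->]; apply: vs_setD; apply: vs_set_sum => i.
  have -> : f i = cat_fam f g (lshift n i) by rewrite /cat_fam (unsplitK (inl i)).
  exact: vs_span_mem.
have -> : g i = cat_fam f g (rshift m i) by rewrite /cat_fam (unsplitK (inr i)).
exact: vs_span_mem.
Qed.

(** The complement [f] is enlarged by the points [g] of a net for the values of [S], so that [c S x]
    is cancelled up to a small error by a vector of the enlarged span. Closedness of the range then
    comes from its finite codimension. *)
Lemma PhiMinus_pert A S (c : R[i]) : closed_linrel A -> net_compact A S ->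
  closed_linrel (lr_pert A S c) -> PhiMinus A -> PhiMinus (lr_pert A S c).
Proof.
move=> cA AS cB [_ _ /vdim_lty[n /quotsp_basisP[f [_ gf]]]].
have [C C0 CP] := complement_solve cA gf.
pose D := complex.Re `|c|; have D0 : 0 <= D by exact: (rnorm_ge0 (c : R[i]^o)).
(* The net is applied after division by [C], so the final error is at most [D * C * q], which this
   choice makes at most 1/2. *)
pose q := (2 * (1 + D) * C)^-1; have q0 : 0 < q by rewrite invr_gt0 !mulr_gt0//; lra.
have [l lP] := AS q q0.
have [N N0 NP] := seq_bound l.
pose g (i : 'I_(size l)) := nth 0 l i.
pose H := lr_plus_span (lr_pert A S c) (cat_fam f g).
have cH : closed (vs_set H) by exact: lr_plus_span_closed.
have Hgen y : exists z, vs_set H (z, y).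
  have [||z _ Hz] := @iterated_approximation _ _ _ H vs_full (C + D * (C * N)) cXX _ y.
  - move=> {}y _ y1; have [x [a [u [Axa fu yE [xC aC uC]]]]] := CP y.
    have xC' : rnorm x <= C by apply: le_trans xC _; rewrite ler_piMr ?(ltW C0).
    have aC' : rnorm a <= C by apply: le_trans aC _; rewrite ler_piMr ?(ltW C0).
    have uC' : rnorm u <= C by apply: le_trans uC _; rewrite ler_piMr ?(ltW C0).
    have Ci : 0 <= C^-1 by rewrite invr_ge0 ltW.
    have CC : C%:C * C^-1%:C = 1 :> R[i].
      by rewrite -(rmorphM (real_complex R)) mulfV ?gt_eqF.
    have [||s [k [Ss kl sk]]] := lP _ _ (graphZ C^-1%:C Axa).
    + by rewrite rnorm_scale// mulrC ler_pdivrMr// mul1r.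
    + by rewrite rnorm_scale// mulrC ler_pdivrMr// mul1r.
    have {}Ss : vs_set S (x, C%:C *: s).
      by have := graphZ C%:C Ss; rewrite scalerA CC scale1r.
    pose k' := c *: (C%:C *: k).
    have gk : vs_set (vs_span g) (- k').
      apply/vs_setN/vs_setZ/vs_setZ; have /(nthP 0)[i il <-] := kl.
      exact: (vs_span_mem g (Ordinal il)).
    have k'N : rnorm k' <= D * (C * N).
      rewrite rnormZ -/D rnorm_scale ?(ltW C0)//; apply: ler_wpM2l => //.
      by apply: ler_wpM2l; [exact: ltW | exact: NP].
    exists (x, u - k'), (a + c *: (C%:C *: s) + (u - k')); split.
    + split; first exact: cat_famP.
      by exists a, (C%:C *: s); split=> //=; rewrite addrK.
    + rewrite rnorm_pair ge_max; have := rnormB u k'.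
      have : 0 <= D * (C * N) by apply: le_trans k'N; exact: rnorm_ge0.
      by move=> kN uk; apply/andP; split; clear -xC' uC' k'N kN uk; lra.
    + by [].
    + have -> : y - (a + c *: (C%:C *: s) + (u - k')) = - (c *: (C%:C *: (s - k))).
        rewrite yE /k' !scalerBr; move: (c *: _) (c *: _) => t t'.
        by rewrite !opprD !opprK [LHS](AC (2*(2*2)) ((1*3)*(2*5)*(4*6))) /= !subrr !add0r.
      rewrite rnormN rnormZ -/D rnorm_scale ?(ltW C0)//.
      have Cq : q * (2 * (1 + D) * C) = 1 by rewrite mulVf// gt_eqF// -invr_gt0.
      have : D * (C * rnorm (s - k)) <= D * (C * q).
        by do 2 (apply: ler_wpM2l => //; try exact: ltW).
      have : 0 < C * q by rewrite mulr_gt0.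
      by clear -Cq; lra.
  - by [].
  - by exists z; exact: cH.
have [m Bm] : exists m, has_basis_of_size (quotsp (lr_ran (lr_pert A S c))) m.
  apply: (@quotsp_fin_gen _ _ _ _ (cat_fam f g)) => y.
  have [[x u] [/= /vs_spanP[d ->] Bx]] := Hgen y.
  by exists d; apply/lr_ranP; exists x.
split=> //; first exact: finite_codim_closed Bm.
by rewrite /lr_beta (vdim_basis Bm) ltry.
Qed.

End PhiMinus.

(** * Local constancy of the index *)

Section LocalIndex.
Context {R : realType} {X : completeNormedModType R[i]}.
Local Open Scope complex_scope.
Implicit Types A B S : linrel X X.

Let cX : geo_complete X := @geo_complete_completeNormedMod R X.

(** A finite 1-net lies in a ball of radius [N], so a suitable value has norm at most [N + 1] on the
    unit ball; homogeneity does the rest. *)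
Lemma net_compact_bounded A S : net_compact A S -> exists2 M : R, 0 <= M &
  forall x a, vs_set A (x, a) -> exists2 s, vs_set S (x, s) &
    rnorm s <= M * (rnorm x + rnorm a).
Proof.
move=> /(_ 1 ltr01)[l lP]; have [N N0 NP] := seq_bound l.
exists (N + 1); first by rewrite addr_ge0.
move=> x a Axa; have x0 := rnorm_ge0 x; have a0 := rnorm_ge0 a.
pose p := rnorm x + rnorm a.
have : 0 <= p by rewrite addr_ge0.
rewrite le_eqVlt => /orP[/eqP p0|p0].
  have xx : x = 0 by apply: rnorm_eq0; rewrite /p in p0; lra.
  exists 0; first by rewrite xx; exact: (vs_set0 S).
  by rewrite rnorm0 mulr_ge0// addr_ge0.
have pi0 : 0 <= p^-1 by rewrite invr_ge0 ltW.
have [||s [k [Ss kl sk]]] := lP _ _ (graphZ p^-1%:C Axa).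
- by rewrite rnorm_scale// mulrC ler_pdivrMr// mul1r lerDl.
- by rewrite rnorm_scale// mulrC ler_pdivrMr// mul1r lerDr.
exists (p%:C *: s).
  have := graphZ p%:C Ss; rewrite scalerA -(rmorphM (real_complex R)) mulfV ?gt_eqF//.
  by rewrite scale1r.
rewrite rnorm_scale ?(ltW p0)// mulrC ler_pM2r//.
have := NP _ kl; have := rnormD (s - k) k; rewrite subrK; lra.
Qed.

(** Absorption of [q / 2] for values that can only be chosen nearly minimal. *)
Lemma halving_bound (Q : set R) (u e : R) : Q !=set0 -> (forall q, Q q -> 0 <= q) ->
  (forall q, Q q -> exists2 q', Q q' & q' <= u + q / 2) -> 0 < e ->
  exists2 q, Q q & q <= 2 * u + e.
Proof.
move=> Q0 Qge QP e0; have hi : has_inf Q by split=> //; exists 0 => q /Qge.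
have e2 : 0 < e / 2 by lra.
have [q Qq qe] := inf_adherent e2 hi; exists q => //.
have [q' Qq' q'q] := QP q Qq; have := ge_inf hi.2 Qq'; lra.
Qed.

Lemma local_kappa A S : admissible A S -> PhiPlus A -> PhiMinus A ->
  exists2 eta : R, 0 < eta & forall c : R[i], complex.Re `|c| < eta ->
    closed_linrel (lr_pert A S c) -> lr_kappa (lr_pert A S c) = lr_kappa A.
Proof.
move=> [cA SA AS] [_ _ /vdim_lty[a Ae]] [_ _ /vdim_lty[b Bf]].
rewrite (kappa_basis Ae Bf).
have /subsp_basisP[e [fe Ne]] := Ae; have /quotsp_basisP[f [ff gf]] := Bf.
have [M M0 MP] := net_compact_bounded AS.
have [C C0 CP] := complement_solve cA gf.
have [k k0 kP] := coefs_bound (@closed_vs_zero R X) fe.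
have ker_e i : vs_set A (e i, 0).
  by suff : vs_set (lr_ker A) (e i) by []; rewrite Ne; exact: vs_span_mem.
have /choice[s sP] : forall i, exists s, vs_set S (e i, s).
  by move=> i; have [s ? _] := MP _ _ (ker_e i); exists s.
pose sig := \sum_i rnorm (s i).
have sig0 : 0 <= sig by apply: sumr_ge0 => i _; exact: rnorm_ge0.
have h1 : 0 <= M * C by rewrite mulr_ge0// ltW.
have h2 : 0 <= k * C * sig by rewrite !mulr_ge0// ltW.
(* [K] gathers the three smallness conditions [e1], [e2], [e3] below: the first serves solving with
   [B] and bounding values of [S], the second the closeness of [w] to [e], the third the closeness
   of the preimage of [span f] to the kernel of [A]. *)
pose K := 4 * (M * C) + 16 * (k * C * sig) + 8 * (C * (2 * M + 1)) + 1.
have h3 : 0 <= C * (2 * M + 1) by rewrite mulr_ge0 ?(ltW C0)//; lra.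
have K0 : 0 < K by rewrite /K; lra.
exists K^-1; first by rewrite invr_gt0.
move=> c; pose q := complex.Re `|c|; rewrite -/q => qK cB.
have q0 : 0 <= q by exact: (rnorm_ge0 (c : R[i]^o)).
have {}qK : q * K < 1 by rewrite -ltr_pdivlMr// div1r.
have q1 : 0 <= q * (M * C) by rewrite mulr_ge0.
have q2 : 0 <= q * (k * C * sig) by rewrite mulr_ge0.
have q3 : 0 <= q * (C * (2 * M + 1)) by rewrite mulr_ge0.
have qK' : 4 * (q * (M * C)) + 16 * (q * (k * C * sig)) + 8 * (q * (C * (2 * M + 1))) + q < 1.
  apply: le_lt_trans qK; rewrite le_eqVlt; apply/orP; left; apply/eqP.
  by rewrite /K; ring.
have [e1 e2 e3] : [/\ q * (M * C) <= 4^-1, 2 * (q * (k * C * sig)) <= 8^-1 &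
    q * (C * (2 * M + 1)) <= 8^-1] by split; lra.
clear qK' qK K0 h1 h2 h3 K.
set B := lr_pert A S c.
(* The splitting for [A] solves for [B] up to the error [c *: s'], of norm at most [2 * q * M * C],
   hence at most 1/2 on the unit ball. *)
have Bsolve y : exists x u, [/\ vs_set B (x, y - u), vs_set (vs_span f) u &
    rnorm x <= 2 * C * rnorm y].
  have cXX := geo_complete_prod cX cX.
  have [||[x u] xu Hz] := @iterated_approximation _ _ _ (lr_plus_span B f) vs_full C cXX _ y.
  - move=> {}y _ y1; have [x [a' [u [Axa fu yE [xC aC uC]]]]] := CP y.
    have xC' : rnorm x <= C by apply: le_trans xC _; rewrite ler_piMr ?(ltW C0).
    have aC' : rnorm a' <= C by apply: le_trans aC _; rewrite ler_piMr ?(ltW C0).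
    have uC' : rnorm u <= C by apply: le_trans uC _; rewrite ler_piMr ?(ltW C0).
    have [s' Ss' s'M] := MP _ _ Axa.
    exists (x, u), (a' + c *: s' + u); split.
    + by split=> //=; rewrite addrK; exists a', s'.
    + by rewrite rnorm_pair ge_max xC'.
    + by [].
    + have -> : y - (a' + c *: s' + u) = - (c *: s').
        by rewrite yE !opprD [LHS](AC (2*(2*1)) ((1*3)*(2*5)*4)) /= !subrr !add0r.
      rewrite rnormN rnormZ -/q; have : q * rnorm s' <= q * (M * (C + C)).
        by rewrite ler_wpM2l// (le_trans s'M)// ler_wpM2l// lerD.
      have -> : q * (M * (C + C)) = 2 * (q * (M * C)) by ring.
      by move/le_trans; apply; move: e1; clear; lra.
  - by [].
  - have [/= fu Bu] := lr_plus_span_closed cB Hz; exists x, u; split=> //.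
    by move: xu; rewrite rnorm_pair ge_max => /andP[].
(* The kernel vector [e i] has the value [c *: s i] under [B]. Solving for this value modulo
   [span f] and subtracting the solution yields [w i], which [B] maps into [span f]. *)
have /choice[p pP] : forall i, exists p : X * X, [/\ vs_set B (p.1, c *: s i - p.2),
    vs_set (vs_span f) p.2 & rnorm p.1 <= 2 * C * rnorm (c *: s i)].
  by move=> i; have [x [u ?]] := Bsolve (c *: s i); exists (x, u).
pose w i := e i - (p i).1.
have Bw i : vs_set B (w i, (p i).2).
  have [Bp _ _] := pP i.
  have Be : vs_set B (e i, c *: s i) by exists 0, (s i); split=> //=; rewrite add0r.
  by have := graphB Be Bp; rewrite opprB addrCA subrr addr0.
have w_near (d : 'I_a -> R[i]^o) :
    rnorm (\sum_i d i *: e i - \sum_i d i *: w i) <= 8^-1 * rnorm (\sum_i d i *: e i).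
  set E := rnorm (\sum_i d i *: e i).
  have -> : \sum_i d i *: e i - \sum_i d i *: w i = \sum_i d i *: (p i).1.
    by rewrite -sumrB; apply: eq_bigr => i _; rewrite -scalerBr /w opprB addrCA subrr addr0.
  apply: le_trans (rnorm_sum _) _.
  apply: (@le_trans _ _ (\sum_i (k * E) * (2 * C * (q * rnorm (s i))))).
    apply: ler_sum => i _; rewrite rnormZ; apply: ler_pM.
    - exact: (rnorm_ge0 (d i)).
    - exact: rnorm_ge0.
    - by apply: (kP (\sum_i d i *: e i) d _ i); rewrite /= subrr.
    - by have [_ _] := pP i; rewrite rnormZ.
  rewrite -!mulr_sumr -/sig.
  have -> : k * E * (2 * C * (q * sig)) = (2 * (q * (k * C * sig))) * E by ring.
  by rewrite ler_wpM2r ?rnorm_ge0.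
have free_w : free_mod vs_zero w.
  move=> d /= d0; apply: fe => /=; apply: rnorm_eq0.
  have := w_near d; rewrite d0 subr0; have := rnorm_ge0 (\sum_i d i *: e i).
  by move: (rnorm _); clear; move=> E; lra.
have Bspan v : vs_set (vs_span w) v -> exists2 u, vs_set (vs_span f) u & vs_set B (v, u).
  move=> /vs_spanP[d ->]; exists (\sum_i d i *: (p i).2).
    by apply: vs_set_sum => i; have [] := pP i.
  exact: graph_sum.
have mulB : vs_set (lr_mul B) = vs_set (lr_mul A) by exact: lr_mul_pert.
(* For a value [s'] of [S] at [v], solve [- (c *: s') = a1 + u1] by [x1]. Then [u + u1] is a value
   of [A] at [v - x1] and lies in [span f], so it is 0 and [v - x1] is in the kernel. It remains to
   choose [s'] small. *)
have near_ker v u : vs_set B (v, u) -> vs_set (vs_span f) u -> 0 < rnorm v ->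
    exists2 n, vs_set (lr_ker A) n & rnorm (v - n) <= 8^-1 * rnorm v.
  move=> [a0 [s0 [/= Aa0 Ss0 uE]]] fu v0.
  have lift s' : vs_set S (v, s') -> exists a1, [/\ vs_set A (v, a1),
      rnorm a1 <= C * (q * rnorm s') &
      exists2 n, vs_set (lr_ker A) n & rnorm (v - n) <= C * (q * rnorm s')].
    move=> Ss'; have [x1 [a1 [u1 [Ax1 fu1 yE [xC aC _]]]]] := CP (- (c *: s')).
    have cs' : rnorm (- (c *: s')) = q * rnorm s' by rewrite rnormN rnormZ.
    rewrite cs' in xC aC.
    have Sd : vs_set (lr_mul S) (s0 - s') by have := graphB Ss0 Ss'; rewrite subrr.
    have Av : vs_set A (v, u - c *: s').
      have := graphD Aa0 (graphZ c (SA _ Sd)).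
      by rewrite uE scaler0 addr0 scalerBr addrA.
    have Avx : vs_set A (v - x1, u + u1).
      have := graphB Av Ax1; congr (vs_set A (_, _)).
      by rewrite yE [a1 + u1]addrC addrA addrK.
    have uu1 : u + u1 = 0.
      have /rcomb_span[d uE'] : vs_set (vs_span f) (u + u1) by exact: vs_setD.
      rewrite uE' ((rcomb_free _ _).1 ff d) ?rcomb0// -uE'.
      by apply/lr_ranP; exists (v - x1).
    rewrite uu1 in Avx; exists a1; split=> //.
      by have := graphD Avx Ax1; rewrite subrK add0r.
    by exists (v - x1) => //; rewrite opprB addrCA subrr addr0.
  (* [a1] is a value of [A] at [v] of norm at most [C * q] times that of [s'], so it yields a new
     value of [S] bounded by [M * rnorm v] plus at most half the norm of [s']. *)
  have [|||_ [s1 Ss1 <-] s1le] := @halving_bound [set rnorm s' | s' in [set s' | vs_set S (v, s')]]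
      (M * rnorm v) (rnorm v) _ _ _ v0.
  - by exists (rnorm s0), s0.
  - by move=> _ [s' _ <-]; exact: rnorm_ge0.
  - move=> _ [s' Ss' <-]; have [a1 [Aa1 a1C _]] := lift s' Ss'.
    have [s1 Ss1 s1M] := MP _ _ Aa1; exists (rnorm s1); first by exists s1.
    apply: le_trans s1M _; rewrite mulrDr lerD2l.
    have : M * rnorm a1 <= M * (C * (q * rnorm s')) by rewrite ler_wpM2l.
    move/le_trans; apply.
    have -> : M * (C * (q * rnorm s')) = q * (M * C) * rnorm s' by ring.
    by rewrite mulrC ler_wpM2l ?rnorm_ge0//; move: e1; clear; lra.
  have [_ [_ _ [n Nn vn]]] := lift s1 Ss1; exists n => //; apply: le_trans vn _.
  apply: (@le_trans _ _ (C * (q * ((2 * M + 1) * rnorm v)))).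
    by rewrite ler_wpM2l ?(ltW C0)// ler_wpM2l// mulrDl mul1r -mulrA.
  have -> : C * (q * ((2 * M + 1) * rnorm v)) = q * (C * (2 * M + 1)) * rnorm v by ring.
  by rewrite ler_wpM2r ?rnorm_ge0.
have pre_w v u : vs_set B (v, u) -> vs_set (vs_span f) u -> vs_set (vs_span w) v.
  move=> Bvu fu; apply: contrapT => nv.
  pose Q := [set rnorm (v - y) | y in vs_set (vs_span w)].
  have Qi : has_inf Q.
    split; last by exists 0 => _ [y _ <-]; exact: rnorm_ge0.
    by exists (rnorm (v - 0)), 0 => //; exact: (vs_set0 (vs_span w)).
  have Qm y : vs_set (vs_span w) y -> inf Q <= rnorm (v - y).
    by move=> wy; apply: ge_inf; [exact: Qi.2 | exists y].
  have inf0 : 0 < inf Q.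
    rewrite ltNge; apply/negP => infQ; apply: nv; apply: (rnorm_closed (@closed_span _ _ _ w)).
    move=> r r0; have [_ [y wy <-] yr] := inf_adherent r0 Qi.
    by exists y => //; apply: lt_le_trans yr _; rewrite gerDr.
  (* [y] is within twice the distance from [v] to [span w]. As [v - y] is within 1/8 of a kernel
     vector, and that one within 1/8 of [span w], both relatively, some vector of [span w] would be
     closer to [v] than the distance allows. *)
  have [_ [y wy <-] yQ] := inf_adherent inf0 Qi.
  have [uy fuy Buy] := Bspan y wy.
  have v0 : 0 < rnorm (v - y) by exact: lt_le_trans inf0 (Qm y wy).
  have [n Nn vn] := near_ker _ _ (graphB Bvu Buy) (vs_setB fu fuy) v0.
  move: Nn; rewrite Ne => /vs_spanP[d nE].
  have := w_near d; rewrite -nE; set y' := \sum_i d i *: w i => ny'.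
  have := Qm (y + y') (vs_setD wy (vs_span_sum w d)).
  have := rnorm_triangle n (v - y) y'; rewrite -addrA -opprD.
  have : rnorm n <= rnorm (v - y) + rnorm (v - y - n).
    by rewrite -{1}(subKr (v - y) n); exact: rnormB.
  by clear -v0 vn ny' yQ; lra.
have [|i|v u|y|r [ra rb Br Rr]] := @index_basis _ _ B a b w f free_w.
- by move=> d; rewrite mulB => Ad; apply: ff; apply/lr_ranP; exists 0.
- by exists (p i).2 => //; have [] := pP i.
- exact: pre_w.
- have [x [u [Bx /vs_spanP[d uE] _]]] := Bsolve y.
  by exists d; rewrite -uE; apply/lr_ranP; exists x.
rewrite (kappa_basis Br Rr); congr EFin.
by rewrite -!subzn// opprB addrA subrK.
Qed.

End LocalIndex.

(** * Essential spectra *)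

(** The supremum of the [r] with [g r = g 0] has this property itself and cannot be less than 1. *)
Lemma locally_constant_01 (R : realType) (Y : Type) (g : R -> Y) :
  (forall r, 0 <= r <= 1 -> exists2 eta, 0 < eta &
    forall r', 0 <= r' <= 1 -> `|r' - r| < eta -> g r' = g r) -> g 0 = g 1.
Proof.
move=> gP; pose E := [set r | 0 <= r <= 1 /\ g r = g 0].
have E0 : E 0 by split=> //; rewrite lexx ler01.
have hE : has_sup E by split; [exists 0 | exists 1 => r [/andP[]]].
pose s := sup E.
have s0 : 0 <= s by apply: ub_le_sup => //; exact: hE.2.
have s1 : s <= 1 by apply: ge_sup; [exists 0 | move=> r [/andP[]]].
have [|eta eta0 etaP] := gP s; first by rewrite s0.
have [r Er sr] := sup_adherent eta0 hE.
have rs : r <= s by apply: ub_le_sup => //; exact: hE.2.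
have gs : g s = g 0.
  have [r01 <-] := Er; apply/esym/etaP => //.
  by rewrite ltr_norml; apply/andP; split; move: sr; rewrite -/s; lra.
have [s1'|s1'] := leP 1 s.
  by rewrite -gs; congr g; apply/eqP; rewrite eq_le s1 s1'.
pose r' := Num.min 1 (s + eta / 2).
have r'1 : r' <= 1 by rewrite /r' ge_min lexx.
have r's : s < r' by rewrite /r' lt_min s1'; lra.
have r'e : r' <= s + eta / 2 by rewrite /r' ge_min lexx orbT.
have r'01 : 0 <= r' <= 1 by rewrite r'1 andbT; lra.
have Er' : E r'.
  split=> //; rewrite -gs; apply: etaP => //.
  by rewrite ltr_norml; apply/andP; split; lra.
by have := ub_le_sup hE.2 Er'; rewrite -/s leNgt r's.
Qed.

Section ResolventSet.
Context {R : realType} {X : normedModType R[i]}.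
Implicit Type T : linrel X X.

Lemma resolvent_rho_e4 T l : closed_linrel (lr_shift l T) ->
  resolvent_set T l -> rho_e4 T l.
Proof.
move=> cT [ker0 ranT].
have kb : has_basis_of_size (subsp (lr_ker (lr_shift l T))) 0.
  apply/subsp_basisP; exists (fun=> 0); split; first by move=> c _ [].
  rewrite ker0; apply/seteqP; split=> x.
    by move=> ->; exact: (vs_set0 (vs_span _)).
  by move=> /vs_spanP[c ->]; rewrite big_ord0.
have rb : has_basis_of_size (quotsp (lr_ran (lr_shift l T))) 0.
  apply/quotsp_basisP; exists (fun=> 0); split; first by move=> c _ [].
  by move=> v; exists (fun=> 0); rewrite ranT.
have cR : closed (vs_set (lr_ran (lr_shift l T))) by rewrite ranT; exact: closedT.
split; last by rewrite (kappa_basis kb rb).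
by split; split=> //; rewrite /lr_alpha /lr_beta ?(vdim_basis kb) ?(vdim_basis rb) ltry.
Qed.

Lemma rho_e4_e1 T : rho_e4 T `<=` rho_e1 T.
Proof. by move=> l [[? _] _]; left. Qed.

(* The connected set [rho_e4 T] contains the resolvent set, so a single component of
   [rho_e1 T] meets the latter. *)
Lemma rho_e5_component T y : connected (rho_e4 T) -> resolvent_set T `<=` rho_e4 T ->
  resolvent_set T !=set0 -> rho_e4 T y ->
  rho_e5 T = connected_component (rho_e1 T) y.
Proof.
move=> c4 r4 [p Tp] Ty.
have comp q : rho_e4 T q -> connected_component (rho_e1 T) y q.
  by move=> Tq; apply: (connected_component_max Ty (@rho_e4_e1 T) c4).
apply/seteqP; split=> z.
  move=> [_ [[x Tx <-] [q [xq Tq]]] xz].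
  rewrite (same_connected_component (comp q (r4 _ Tq))).
  by rewrite -(same_connected_component xq).
move=> yz; exists (connected_component (rho_e1 T) y) => //; split.
  by exists y => //; exact: rho_e4_e1.
by exists p; split=> //; exact/comp/r4.
Qed.

End ResolventSet.

(** * The segment from [T] to [T + S] *)

Section Homotopy.
Context {R : realType} {X : completeNormedModType R[i]}.
Local Open Scope complex_scope.
Variables T S : linrel X X.
Hypotheses (T_closed : closed_linrel T) (S_Tcompact : rel_compact S T).
Hypothesis (S_Tbound : rel_bound_lt1 S T).
Hypothesis (S_dom : vs_set (lr_dom T) `<=` vs_set (lr_dom S)).
Hypothesis (S_mul : vs_set (lr_mul S) `<=` vs_set (lr_mul T)).

Let A (l : R[i]) (r : R) := lr_pert (lr_shift l T) S (- r%:C).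

Let A0 l : A l 0 = lr_shift l T.
Proof.
rewrite /A oppr0; apply: lr_pert0 => x [y /lr_shiftP[t Tt _]].
by apply: S_dom; exists t.
Qed.

Let A1 l : A l 1 = lr_shift l (lr_add T S).
Proof. by rewrite lr_shift_add. Qed.

Let A_pert l r r' : A l r' = lr_pert (A l r) S (- (r' - r)%:C).
Proof.
rewrite /A lr_pert_pert ?lr_mul_shift//; congr lr_pert.
by rewrite (rmorphB (real_complex R)) opprB addrA addNr sub0r.
Qed.

Let A_admissible l r : 0 <= r <= 1 -> admissible (A l r) S.
Proof.
move=> /andP[r0 r1]; have [a [b [a0 b0 b1 ST]]] := rel_bound_graph S_dom S_Tbound.
by apply: (pert_admissible a0 b0 b1 ST) => //; exact: rel_compact_graph.
Qed.

Let A_PhiPlus l r r' : 0 <= r <= 1 -> 0 <= r' <= 1 -> PhiPlus (A l r) -> PhiPlus (A l r').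
Proof.
(* [PhiPlus_pert] passes from the perturbed to the unperturbed relation, so the known member [A l r]
   is written as a perturbation of [A l r']. *)
move=> r01 r'01; rewrite (A_pert l r' r); have [cA _ nA] := A_admissible l r'01.
exact: PhiPlus_pert.
Qed.

Let A_PhiMinus l r r' : 0 <= r <= 1 -> 0 <= r' <= 1 -> PhiMinus (A l r) -> PhiMinus (A l r').
Proof.
move=> r01 r'01; rewrite (A_pert l r r'); have [cA _ nA] := A_admissible l r01.
by apply: PhiMinus_pert => //; rewrite -A_pert; have [] := A_admissible l r'01.
Qed.

Let A_kappa l : Phi (A l 0) -> lr_kappa (A l 0) = lr_kappa (A l 1).
Proof.
move=> [P M]; have z01 : 0 <= (0 : R) <= 1 by rewrite lexx ler01.
apply: (@locally_constant_01 R _ (fun r => lr_kappa (A l r))) => r r01.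
have [eta eta0 etaP] := local_kappa (A_admissible l r01)
  (A_PhiPlus z01 r01 P) (A_PhiMinus z01 r01 M).
exists eta => // r' r'01 rr'; rewrite [A l r'](A_pert l r r'); apply: etaP.
  rewrite normrN normc_def /= expr0n addr0 sqrtr_sqr.
  exact: rr'.
by rewrite -A_pert; have [] := A_admissible l r'01.
Qed.

Let i01 : 0 <= (0 : R) <= 1. Proof. by rewrite lexx ler01. Qed.
Let i11 : 0 <= (1 : R) <= 1. Proof. by rewrite lexx ler01. Qed.

Lemma PhiPlus_addE l : PhiPlus (lr_shift l (lr_add T S)) <-> PhiPlus (lr_shift l T).
Proof. by rewrite -A0 -A1; split; exact: A_PhiPlus. Qed.

Lemma PhiMinus_addE l : PhiMinus (lr_shift l (lr_add T S)) <-> PhiMinus (lr_shift l T).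
Proof. by rewrite -A0 -A1; split; exact: A_PhiMinus. Qed.

Lemma Phi_addE l : Phi (lr_shift l (lr_add T S)) <-> Phi (lr_shift l T).
Proof. by rewrite /Phi PhiPlus_addE PhiMinus_addE. Qed.

Lemma kappa_addE l : Phi (lr_shift l T) ->
  lr_kappa (lr_shift l (lr_add T S)) = lr_kappa (lr_shift l T).
Proof. by rewrite -A0 -A1 => /A_kappa ->. Qed.

Lemma shift_add_closed l : closed_linrel (lr_shift l (lr_add T S)).
Proof. by rewrite -A1; have [] := A_admissible l i11. Qed.

Lemma shift_closed l : closed_linrel (lr_shift l T).
Proof. by rewrite -A0; have [] := A_admissible l i01. Qed.

End Homotopy.

Theorem theorem4p4 (R : realType) (X : completeNormedModType R[i])
    (T S : linrel X X)
    (T_closed : closed_linrel T)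
    (S_Tcompact : rel_compact S T)
    (S_Tbound : rel_bound_lt1 S T)
    (S_dom : closure (vs_set (lr_dom T)) `<=` vs_set (lr_dom S))
    (S_mul : vs_set (lr_mul S) `<=` vs_set (lr_mul T)) :
  [/\ sigma_e1 (lr_add T S) = sigma_e1 T,
      sigma_e2 (lr_add T S) = sigma_e2 T,
      sigma_e3 (lr_add T S) = sigma_e3 T &
      sigma_e4 (lr_add T S) = sigma_e4 T] /\
  (connected (rho_e4 T) ->
   resolvent_set T !=set0 ->
   resolvent_set (lr_add T S) !=set0 ->
   sigma_e5 (lr_add T S) = sigma_e5 T).
Proof.
have dTS : vs_set (lr_dom T) `<=` vs_set (lr_dom S).
  by move=> x Tx; apply: S_dom; exact: subset_closure.
have P := PhiPlus_addE T_closed S_Tcompact S_Tbound dTS S_mul.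
have M := PhiMinus_addE T_closed S_Tcompact S_Tbound dTS S_mul.
have F := Phi_addE T_closed S_Tcompact S_Tbound dTS S_mul.
have k := kappa_addE T_closed S_Tcompact S_Tbound dTS S_mul.
have e1 : rho_e1 (lr_add T S) = rho_e1 T.
  by apply/seteqP; split=> l; rewrite /rho_e1 /= P M.
have e4 : rho_e4 (lr_add T S) = rho_e4 T.
  apply/seteqP; split=> l [].
    by move=> /F FT; rewrite k.
  by move=> FT kT; split; [exact/F | rewrite k].
have e2 : rho_e2 (lr_add T S) = rho_e2 T by apply/seteqP; split=> l; rewrite /rho_e2 /= P.
have e3 : rho_e3 (lr_add T S) = rho_e3 T by apply/seteqP; split=> l; rewrite /rho_e3 /= F.
split; first by rewrite /sigma_e1 /sigma_e2 /sigma_e3 /sigma_e4 e1 e2 e3 e4.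
move=> c4 rT rTS; rewrite /sigma_e5; congr setC.
have T4 : resolvent_set T `<=` rho_e4 T.
  by move=> l; apply: resolvent_rho_e4; exact: shift_closed S_Tcompact S_Tbound dTS S_mul l.
have TS4 : resolvent_set (lr_add T S) `<=` rho_e4 (lr_add T S).
  by move=> l; apply: resolvent_rho_e4; exact: shift_add_closed S_Tcompact S_Tbound dTS S_mul l.
have [p /T4 p4] := rT.
(* Both sets are the component of the same point [p] in the common [rho_e1]. *)
rewrite (rho_e5_component c4 T4 rT p4) -e1; apply: rho_e5_component => //.
  by rewrite e4.
by rewrite e4.
Qed.
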